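(* Let $G$ and $H$ be locally compact groups and let $A=A_\pi$ be a closed translation-invariant subalgebra of $B(G)$ for which $\Delta(A)$ is a $*$-semigroup consisting of norm-one elements. If $H_0$ is an open subgroup of $H$ and $\alpha: H_0\to\Delta(A)$ is a continuous homomorphism (i.e. $\alpha(st)=\alpha(s)\alpha(t)$ for $s,t\in H_0$), then $j_\alpha: A\to B(H)$ is a completely positive homomorphism, where $j_\alpha(u)(h)=\langle\alpha(h),u\rangle$ for $h\in H_0$ and $j_\alpha(u)(h)=0$ for $h\in H\setminus H_0$.
   Context: $B(G)$ is the Fourier–Stieltjes algebra. For a continuous unitary representation $\{\pi,\mathcal H_\pi\}$ of $G$, $A_\pi$ is the closed linear span in $B(G)$ of the functions $\xi*_\pi\eta(s)=\langle\pi(s)\xi|\eta\rangle$, and $VN_\pi$ is the von Neumann algebra generated by $\pi(G)$, identified with $A_\pi^*$ via $\langle T,\xi*_\pi\eta\rangle=\langle T\xi|\eta\rangle$. Closed translation-invariant subspaces of $B(G)$ are exactly the $A_\pi$'s. $W^*(H)=B(H)^*$ is the von Neumann algebra generated by the universal representation of $H$. $\Delta(A)\subseteq A^*=VN_\pi$ is the Gelfand spectrum with the weak$^*$-topology; ''$\Delta(A)$ is a $*$-semigroup'' means that it is closed under the product and involution of $VN_\pi$ (this and the norm-one condition hold, for example, when $A$ is unital or $A=A(G)$, the Fourier algebra). A map $\varphi:A_\pi\to B(H)$ is completely positive when its dual map $\varphi^*:W^*(H)\to VN_\pi$ is completely positive. *)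

(* Defs.v *)
From HB Require Import structures.
From mathcomp Require Import all_boot all_order all_algebra.
From mathcomp Require Import complex.
From mathcomp Require Import all_classical all_reals all_analysis.

Set Implicit Arguments.
Unset Strict Implicit.
Unset Printing Implicit Defensive.

Import Order.TTheory GRing.Theory Num.Theory.
Import numFieldNormedType.Exports.

Local Open Scope classical_set_scope.
Local Open Scope ring_scope.
Local Open Scope complex_scope.

HB.mixin Record isTopologicalGroup G of Topological G & Group G := {
  mulg_continuous : continuous (fun x : G * G => (x.1 * x.2)%g);
  invg_continuous : continuous (fun x : G => (x^-1)%g) }.

#[short(type="topGroupType")]
HB.structure Definition TopGroup :=
  {G of isTopologicalGroup G & Topological G & Group G}.

Definition locally_compact_group (G : topGroupType) : Prop :=
  hausdorff_space G /\ locally_compact [set: G].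

Definition is_subgroup (G : topGroupType) (H0 : set G) : Prop :=
  [/\ H0 1%g, forall s t, H0 s -> H0 t -> H0 (s * t)%g
    & forall s, H0 s -> H0 (s^-1)%g].

HB.mixin Record isHilbert (R : realType) E of CompleteNormedModule R[i] E := {
  inner : E -> E -> R[i];
  inner_linear : forall (a : R[i]) (x y z : E),
    inner (a *: x + y) z = a * inner x z + inner y z;
  inner_conj : forall x y : E, inner y x = (inner x y)^*;
  inner_norm : forall x : E, inner x x = `|x| ^+ 2 }.

#[short(type="hilbertType")]
HB.structure Definition Hilbert (R : realType) :=
  {E of isHilbert R E & CompleteNormedModule R[i] E}.

Section Operators.
Context {R : realType} {E : hilbertType R}.
Implicit Types (S T : E -> E) (M : set (E -> E)).

Definition bounded_op T : Prop := linear T /\ continuous T.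

Definition op_norm T : R :=
  sup [set complex.Re `|T x| | x in [set x : E | `|x| <= 1]].

Definition is_adjoint T T' : Prop :=
  bounded_op T' /\ forall x y, inner (T x) y = inner x (T' y).

Definition commutant M : set (E -> E) :=
  [set T | bounded_op T /\ forall S, M S -> T \o S = S \o T].

(* positivity of the matrix [S_ij] as an operator on E^n *)
Definition positive_opmx n (S : 'I_n -> 'I_n -> E -> E) : Prop :=
  forall x : 'I_n -> E, 0 <= \sum_i \sum_j inner (S i j (x j)) (x i).

End Operators.

Definition completely_positive_op (R : realType) (E F : hilbertType R)
    (M : set (E -> E)) (Phi : (E -> E) -> (F -> F)) : Prop :=
  (forall (a : R[i]) S T, M S -> M T ->
     Phi (fun x => a *: S x + T x) = (fun y => a *: Phi S y + Phi T y)) /\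
  (forall n (S : 'I_n -> 'I_n -> E -> E), (forall i j, M (S i j)) ->
     positive_opmx S -> positive_opmx (fun i j => Phi (S i j))).

Record unitary_rep (R : realType) (G : topGroupType) (E : hilbertType R) := {
  rep_fun :> G -> E -> E;
  rep_linear : forall s, linear (rep_fun s);
  rep1 : forall x, rep_fun 1%g x = x;
  repM : forall s t x, rep_fun (s * t)%g x = rep_fun s (rep_fun t x);
  rep_inner : forall s x y, inner (rep_fun s x) (rep_fun s y) = inner x y;
  rep_continuous : forall x, continuous (fun s => rep_fun s x) }.

Section FourierStieltjes.
Context {R : realType} {G : topGroupType}.
Implicit Types (u v : G -> R[i]) (A : set (G -> R[i])).

Definition coef (E : hilbertType R) (pi : unitary_rep G E) (x y : E)
  : G -> R[i] := fun s => inner (pi s x) y.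

(* B(G) *)
Definition BG : set (G -> R[i]) :=
  [set u | exists (E : hilbertType R) (pi : unitary_rep G E) (x y : E),
             u = coef pi x y].

(* the norm of B(G): the infimum of |x| |y| over all u = <pi(.)x|y> *)
Definition BG_norm u : R :=
  inf [set r | exists (E : hilbertType R) (pi : unitary_rep G E) (x y : E),
                 u = coef pi x y /\ r = complex.Re (`|x| * `|y|)].

Definition BG_closed A : Prop :=
  forall u, BG u ->
    (forall e : R, 0 < e -> exists2 v, A v & BG_norm (u \- v) < e) -> A u.

Definition translation_invariant A : Prop :=
  forall u, A u -> forall t,
    A (fun s => u (t * s)%g) /\ A (fun s => u (s * t)%g).

Definition is_subalgebra A : Prop :=
  [/\ A `<=` BG, A (fun=> 0),
      forall (a : R[i]) u v, A u -> A v -> A (a \*o u \+ v)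
    & forall u v, A u -> A v -> A (u \* v)].

(* the dual A^* of a subspace A of B(G); only the restriction to A matters *)
Definition dual_space A : set ((G -> R[i]) -> R[i]) :=
  [set f | (forall (a : R[i]) u v, A u -> A v ->
              f (a \*o u \+ v) = a * f u + f v) /\
           exists M : R, forall u, A u -> complex.Re `|f u| <= M * BG_norm u].

Section Api.
Context {E : hilbertType R} (pi : unitary_rep G E).

Definition coef_span : set (G -> R[i]) :=
  [set u | exists n (c : 'I_n -> R[i]) (x y : 'I_n -> E),
             u = fun s => \sum_i c i * coef pi (x i) (y i) s].

(* A_pi *)
Definition Api : set (G -> R[i]) :=
  [set u | BG u /\ forall e : R, 0 < e ->
             exists2 v, coef_span v & BG_norm (u \- v) < e].

(* VN_pi, as the bicommutant of pi(G), which is stable under adjoints *)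
Definition VN : set (E -> E) := commutant (commutant (range pi)).

(* The pairing <T,u> of VN_pi with A_pi: T is identified with the unique (on
   A_pi) bounded functional sending each <pi(.)x|y> to <Tx|y>. *)
Definition pairing (T : E -> E) : (G -> R[i]) -> R[i] :=
  xget (fun=> 0) [set f | dual_space Api f /\
                          forall x y, f (coef pi x y) = inner (T x) y].

(* Delta(A_pi), as a subset of VN_pi = A_pi^* *)
Definition spectrum : set (E -> E) :=
  [set T | [/\ VN T, exists2 u, Api u & pairing T u != 0
             & forall u v, Api u -> Api v ->
                 pairing T (u \* v) = pairing T u * pairing T v]].

Definition star_semigroup (D : set (E -> E)) : Prop :=
  (forall S T, D S -> D T -> D (S \o T)) /\
  (forall T, D T -> exists2 T', is_adjoint T T' & D T').

(* sigma(A_pi^*, A_pi) is the topology of pointwise convergence on A_pi *)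
Definition weak_star (T : E -> E) : {ptws Api -> R[i]^o} :=
  fun a => pairing T (val a).

End Api.

(** The universal representation: the Hilbert sum of the GNS representations
    of all continuous positive definite functions p with p(1) = 1. *)

Definition positive_definite u : Prop :=
  forall n (c : 'I_n -> R[i]) (s : 'I_n -> G),
    0 <= \sum_i \sum_j c i * ((c j)^*)%C * u ((s j)^-1 * s i)%g.

Definition states : set (G -> R[i]) :=
  [set p | [/\ continuous (p : G -> R[i]^o), positive_definite p & p 1%g = 1]].

(* The representation is determined up to unitary equivalence by the cyclic
   vectors xi p of its mutually orthogonal GNS summands. *)
Definition is_universal (E : hilbertType R) (om : unitary_rep G E) : Prop :=
  exists xi : (G -> R[i]) -> E,
    [/\ forall p, states p -> coef om (xi p) (xi p) = p,
        forall p q, states p -> states q -> p <> q ->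
          forall s t, inner (om s (xi p)) (om t (xi q)) = 0
      & closure [set x | exists n (c : 'I_n -> R[i]) (s : 'I_n -> G)
                           (p : 'I_n -> G -> R[i]),
                   (forall i, states (p i)) /\
                   x = \sum_i c i *: om (s i) (xi (p i))] = [set: E]].

End FourierStieltjes.

Arguments weak_star {R G E} pi T _.

Section Maps.
Context {R : realType} {G H : topGroupType}.
Implicit Types (phi : (G -> R[i]) -> (H -> R[i])).

Definition algebra_homomorphism (A : set (G -> R[i])) phi : Prop :=
  [/\ forall u, A u -> BG (phi u),
      forall (a : R[i]) u v, A u -> A v ->
        phi (a \*o u \+ v) = a \*o phi u \+ phi v
    & forall u v, A u -> A v -> phi (u \* v) = phi u \* phi v].

Definition bounded_on (A : set (G -> R[i])) phi : Prop :=
  exists M : R, forall u, A u -> BG_norm (phi u) <= M * BG_norm u.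

Context {E : hilbertType R} (pi : unitary_rep G E).

(* Phi is the dual map phi^* : W^*(H) = VN_om -> VN_pi *)
Definition is_dual_map (K : hilbertType R) (om : unitary_rep H K) phi
    (Phi : (K -> K) -> (E -> E)) : Prop :=
  forall S, VN om S ->
    VN pi (Phi S) /\
    forall u, Api pi u -> pairing pi (Phi S) u = pairing om S (phi u).

(* boundedness is what makes the dual map meaningful *)
Definition completely_positive phi : Prop :=
  bounded_on (Api pi) phi /\
  forall (K : hilbertType R) (om : unitary_rep H K), is_universal om ->
    exists2 Phi, is_dual_map om phi Phi & completely_positive_op (VN om) Phi.

Definition j_map (H0 : set H) (alpha : H -> E -> E)
  : (G -> R[i]) -> (H -> R[i]) :=
  fun u h => if h \in H0 then pairing pi (alpha h) u else 0.

End Maps.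

(* Main.v *)
Require Import Defs.
From HB Require Import structures.
From mathcomp Require Import all_boot all_order all_algebra.
From mathcomp Require Import complex.
From mathcomp Require Import all_classical all_reals all_analysis.
From mathcomp Require Import ring lra.
Import Order.TTheory GRing.Theory Num.Theory.
Import numFieldNormedType.Exports.
Set Implicit Arguments.
Unset Strict Implicit.
Unset Printing Implicit Defensive.
Local Open Scope classical_set_scope.
Local Open Scope ring_scope.

(** The idea is to implement j_alpha by unitary representations of H.

    Each alpha(h), h in H_0, is a contraction, and alpha(h) alpha(h^-1) is the
    idempotent alpha(1).  A contractive idempotent is an orthogonal projection,
    so alpha(h)^* = alpha(h^-1) (alpha_adj): alpha is a unitary representation
    of H_0 on the range of alpha(1).  As H_0 is open, inducing it to H makes
    every coefficient of alpha, extended by 0 outside H_0, a coefficient of a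
    representation of H (induced_rep, partial_rep_coef).  In particular
    j_alpha(<pi(.)x|y>) = <sigma(.)Vx|Vy> for a single sigma and a single V
    (j_coef_pi).

    An element u of A is only a limit of sums of such coefficients.  Write
    u = <rho(.)x|y> with any representation rho of G.  The vectors a for which
    all <rho(.)a|b> lie in A form a closed invariant subspace (coef_sub), and
    two orthogonal projections move x and y into it without changing u or
    increasing the norms (coef_reduce).  A bounded functional f on A gives the
    bounded form (a, b) |-> f(<rho(.)a|b>) on this subspace, hence an operator
    (functional_op).  The operators obtained from the functionals alpha(h)
    multiply and have adjoints as the alpha(h) do, because both facts are
    identities between functionals on A, which may be tested on the
    coefficients of pi (pairing_comp, pairing_adj, dual_ext).  Inducing this
    representation of H_0 shows that j_alpha(u) is in B(H), of norm at most
    |x||y|; so j_alpha is a contraction (j_bounded).  It is multiplicative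
    because each alpha(h) is.

    Let om be the universal representation of H.  Cyclic representations embed
    in om, so every function in B(H) is a coefficient of om (universal_coef),
    and an element S of VN_om respects the linear relations between
    coefficients (bicommutant); hence S is a bounded functional on B(H)
    (universal_pairing).  The operator Phi(S) is that of the bounded form
    (x, y) |-> <S, j_alpha(<pi(.)x|y>)>; it commutes with the commutant of
    pi(G) (dual_map_exists).  Positivity of a matrix [Phi(S_ij)] means
    positivity of the sums of the <S_ij, <sigma(.)Vx_j|Vx_i>>.  To compare these
    with sums in the space of om, the vectors Vx_i are split along mutually
    orthogonal cyclic subspaces, each of which embeds in om
    (positive_extension).

    Both the space of the induced representation and the finite multiples of a
    representation are Hilbert sums of copies of one Hilbert space (ell2). *)

Local Open Scope complex_scope.

(** * Norms and inner products *)

Section Nrm.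
Context {R : realType}.
(** The norm of a complex normed space has values in R[i]; its real part is the
    usual real norm, on which real arithmetic can be used. *)
Definition nrm (V : normedZmodType R[i]) (x : V) : R := complex.Re `|x|.

Context {V : normedZmodType R[i]}.
Implicit Types (x y : V).

Lemma nrmE x : `|x| = (nrm x)%:C.
Proof.
rewrite /nrm; have := normr_ge0 x; case: (`|x|) => a b; rewrite lecE /= => /andP[/eqP b0 _].
by rewrite b0.
Qed.

Lemma nrm_ge0 x : 0 <= nrm x.
Proof. by have := normr_ge0 x; rewrite nrmE lecE /= => /andP[]. Qed.

Lemma nrmD x y : nrm (x + y) <= nrm x + nrm y.
Proof. by have := ler_normD x y; rewrite !nrmE -rmorphD lecR. Qed.

Lemma nrmN x : nrm (- x) = nrm x.
Proof. by rewrite /nrm normrN. Qed.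

Lemma nrmB x y : nrm (x - y) = nrm (y - x).
Proof. by rewrite /nrm distrC. Qed.

Lemma nrm0 : nrm (0 : V) = 0.
Proof. by rewrite /nrm normr0. Qed.

Lemma nrm_eq0 x : nrm x = 0 -> x = 0.
Proof. by move=> h; apply/normr0_eq0; rewrite nrmE h. Qed.

Lemma nrm_dist x y z : nrm (x - z) <= nrm (x - y) + nrm (y - z).
Proof. by rewrite (le_trans _ (nrmD _ _))// subrKA. Qed.

Lemma nrm_sep x y : (forall e, 0 < e -> nrm (x - y) < e) -> x = y.
Proof.
move=> h; apply/eqP; rewrite -subr_eq0; apply/eqP/nrm_eq0/eqP.
rewrite eq_le nrm_ge0 andbT leNgt; apply/negP => /h; by rewrite ltxx.
Qed.
Lemma ball_nrm x y (e : R) : `|x - y| < e%:C <-> nrm (x - y) < e.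
Proof. by rewrite nrmE ltcR. Qed.
End Nrm.

Section Nrmc.
Context {R : realType}.
Implicit Types a b : R[i].
Lemma nrmM a b : nrm (a * b) = nrm a * nrm b.
Proof. by apply: (@complexI R); rewrite rmorphM /= -!nrmE normrM. Qed.
Lemma nrmZ (V : normedModType R[i]) a (x : V) : nrm (a *: x) = nrm a * nrm x.
Proof. by apply: (@complexI R); rewrite rmorphM /= -!nrmE normrZ. Qed.
Lemma nrm_real (r : R) : nrm r%:C = `|r|.
Proof. by rewrite /nrm normc_def /= expr0n addr0 sqrtr_sqr. Qed.
Lemma nrm_conj a : nrm a^* = nrm a.
Proof. by rewrite /nrm; case: a => a b /=; rewrite sqrrN. Qed.
Lemma Re_le_nrm a : complex.Re a <= nrm a.
Proof. by have := normc_ge_Re a; rewrite nrmE lecR; apply: le_trans; exact: ler_norm. Qed.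
End Nrmc.
Section Inner.
Context {R : realType} {E : hilbertType R}.
Implicit Types (x y z : E) (a : R[i]).

Lemma innerDl x y z : inner (x + y) z = inner x z + inner y z.
Proof. by have := inner_linear 1 x y z; rewrite scale1r mul1r. Qed.
Lemma inner0l z : inner (0 : E) z = 0.
Proof. by apply: (addrI (inner (0 : E) z)); rewrite -innerDl !addr0. Qed.
Lemma innerZl a x z : inner (a *: x) z = a * inner x z.
Proof. by have := inner_linear a x 0 z; rewrite !addr0 inner0l addr0. Qed.
Lemma innerNl x z : inner (- x) z = - inner x z.
Proof. by rewrite -scaleN1r innerZl mulN1r. Qed.
Lemma innerBl x y z : inner (x - y) z = inner x z - inner y z.
Proof. by rewrite innerDl innerNl. Qed.
Lemma innerDr z x y : inner z (x + y) = inner z x + inner z y.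
Proof. by rewrite inner_conj innerDl rmorphD /= -!inner_conj. Qed.
Lemma inner0r z : inner z (0 : E) = 0.
Proof. by rewrite inner_conj inner0l rmorph0. Qed.
Lemma innerZr a z x : inner z (a *: x) = (a^*)%C * inner z x.
Proof. by rewrite inner_conj innerZl rmorphM /= -inner_conj. Qed.
Lemma innerNr z x : inner z (- x) = - inner z x.
Proof. by rewrite inner_conj innerNl rmorphN /= -inner_conj. Qed.
Lemma innerBr z x y : inner z (x - y) = inner z x - inner z y.
Proof. by rewrite innerDr innerNr. Qed.
Lemma inner_suml (I : Type) (r : seq I) (P : pred I) (F : I -> E) z :
  inner (\sum_(i <- r | P i) F i) z = \sum_(i <- r | P i) inner (F i) z.
Proof. exact: (big_morph (fun x => inner x z) (fun x y => innerDl x y z) (inner0l z)). Qed.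
Lemma inner_sumr (I : Type) (r : seq I) (P : pred I) (F : I -> E) z :
  inner z (\sum_(i <- r | P i) F i) = \sum_(i <- r | P i) inner z (F i).
Proof. exact: (big_morph (fun x => inner z x) (fun x y => innerDr z x y) (inner0r z)). Qed.

Lemma inner_nrm x : inner x x = (nrm x ^+ 2)%:C.
Proof. by rewrite inner_norm nrmE rmorphXn. Qed.

Lemma nrm_sqr x : nrm x ^+ 2 = complex.Re (inner x x).
Proof. by rewrite inner_nrm. Qed.

Lemma mulc_conj a : a * (a^*)%C = (nrm a ^+ 2)%:C.
Proof.
case: a => a b; rewrite /nrm normc_def /= sqr_sqrtr ?addr_ge0 ?sqr_ge0//.
by apply/eqP; rewrite eq_complex /=; apply/andP; split; apply/eqP; ring.
Qed.

Lemma cauchy_schwarz x y : nrm (inner x y) <= nrm x * nrm y.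
Proof.
have [->|y0] := eqVneq y 0; first by rewrite inner0r !nrm0 mulr0.
have ny : 0 < nrm y.
  by rewrite lt_neqAle nrm_ge0 andbT eq_sym; apply: contra_neq y0 => /nrm_eq0.
pose c := inner x y; pose z := (nrm y ^+ 2)%:C *: x - c *: y.
have hz : nrm z ^+ 2 = nrm y ^+ 2 * (nrm y ^+ 2 * nrm x ^+ 2 - nrm c ^+ 2).
  apply: (@complexI R); rewrite -inner_nrm /z !(innerBl, innerBr, innerZl, innerZr).
  rewrite (inner_conj x y) -/c !inner_nrm.
  rewrite conjc_real.
  have := mulc_conj c; move: (nrm c ^+ 2) (nrm y ^+ 2) (nrm x ^+ 2) => C u v.
  by rewrite !(rmorphM, rmorphB) /= => <-; ring.
rewrite -(@ler_pXn2r _ 2) ?nnegrE ?mulr_ge0 ?nrm_ge0// exprMn.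
have := sqr_ge0 (nrm z); rewrite hz pmulr_rge0 ?exprn_gt0// subr_ge0.
by rewrite [X in _ <= X]mulrC.
Qed.

Lemma parallelogram x y :
  nrm (x + y) ^+ 2 + nrm (x - y) ^+ 2 = 2 * nrm x ^+ 2 + 2 * nrm y ^+ 2.
Proof.
rewrite !nrm_sqr !(innerBl, innerBr, innerDl, innerDr) !(raddfD, raddfB) /=; ring.
Qed.

Lemma inner_ext x y : (forall z, inner x z = inner y z) -> x = y.
Proof.
move=> h; apply/eqP; rewrite -subr_eq0; apply/eqP/nrm_eq0/eqP.
by rewrite -sqrf_eq0 nrm_sqr innerBl h subrr.
Qed.

Lemma inner_eq0 x : inner x x = 0 -> x = 0.
Proof. by move=> h; apply/nrm_eq0/eqP; rewrite -sqrf_eq0 nrm_sqr h. Qed.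

Lemma pythagoras x y : inner x y = 0 -> nrm (x + y) ^+ 2 = nrm x ^+ 2 + nrm y ^+ 2.
Proof.
move=> h; rewrite !nrm_sqr !(innerDl, innerDr) (inner_conj x y) h rmorph0.
by rewrite !addr0 add0r raddfD.
Qed.

(** Together with Im_inner this recovers the inner product from the norm. *)
Lemma Re_inner x y :
  complex.Re (inner x y) = (nrm (x + y) ^+ 2 - nrm (x - y) ^+ 2) / 4.
Proof.
rewrite !nrm_sqr !(innerBl, innerBr, innerDl, innerDr) (inner_conj x y).
rewrite !(raddfD, raddfB) /=; case: (inner x y) => a b /=; by field.
Qed.

Lemma Im_inner x y : complex.Im (inner x y) = complex.Re (inner x ((0 +i* 1)%C *: y)).
Proof. rewrite innerZr; case: (inner x y) => a b /=; ring. Qed.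

End Inner.

(** Polarization expresses inner products through the norms of linear
    combinations, on which the two maps agree. *)
Lemma polarize {R : realType} {E F F' : hilbertType R} (T : E -> F) (P : E -> F') :
  linear T -> linear P -> (forall x, nrm (T x) = nrm (P x)) ->
  forall x y, inner (T x) (T y) = inner (P x) (P y).
Proof.
have aux (K : hilbertType R) (S : E -> K) : linear S ->
    [/\ forall x y, S (x + y) = S x + S y, forall x y, S (x - y) = S x - S y
      & forall a x, S (a *: x) = a *: S x].
  move=> lS; have SD x y : S (x + y) = S x + S y by have := lS 1 x y; rewrite !scale1r.
  have S0 : S 0 = 0 by apply: (addrI (S 0)); rewrite -SD !addr0.
  have SZ a x : S (a *: x) = a *: S x by have := lS a x 0; rewrite S0 !addr0.
  by split=> // x y; rewrite SD -scaleN1r SZ scaleN1r.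
move=> /aux[TD TB TZ] /aux[PD PB PZ] iT.
have ReE x y : complex.Re (inner (T x) (T y)) = complex.Re (inner (P x) (P y)).
  by rewrite !Re_inner -TD -PD -TB -PB !iT.
move=> x y; apply/eqP; rewrite eq_complex ReE eqxx /=.
by rewrite !Im_inner -TZ -PZ ReE.
Qed.

Lemma isometry_inner {R : realType} {E F : hilbertType R} (T : E -> F) :
  linear T -> (forall x, nrm (T x) = nrm x) ->
  forall x y, inner (T x) (T y) = inner x y.
Proof. by move=> lT; apply: polarize. Qed.

(** * Completeness, orthogonal projections and the Riesz theorem *)

Section Completeness.
Context {R : realType} {V : normedModType R[i]}.

Lemma posCP (e : R[i]) : 0 < e -> exists2 r : R, 0 < r & e = r%:C.
Proof.
case: e => a b; rewrite ltcE /= => /andP[/eqP -> a0]; by exists a.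
Qed.

(** Real epsilons suffice, since the positive elements of R[i] are the positive
    reals. *)
Lemma cvg_nrm (T : Type) (F : set_system T) (FF : Filter F) (f : T -> V) (l : V) :
  f @ F --> l <-> forall e : R, 0 < e -> \forall y \near F, nrm (l - f y) < e.
Proof.
split=> [/cvgrPdist_lt h e e0|h].
  have e0' : 0 < e%:C by rewrite ltcR.
  by apply: filterS (h _ e0') => y /=; rewrite ball_nrm.
apply/cvgrPdist_lt => _ /posCP[e e0 ->].
by apply: filterS (h _ e0) => y /= ?; rewrite ball_nrm.
Qed.

Lemma continuous_nrm (T : topologicalType) (f : T -> V) (x : T) :
  {for x, continuous f} <->
  forall e : R, 0 < e -> \forall y \near x, nrm (f x - f y) < e.
Proof. exact: cvg_nrm. Qed.

End Completeness.

Lemma seq_complete {R : realType} {V : completeNormedModType R[i]} (x : nat -> V) :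
  (forall e : R, 0 < e -> exists N, forall n m, (N <= n)%N -> (N <= m)%N ->
     nrm (x n - x m) < e) ->
  exists l, forall e : R, 0 < e -> exists N, forall n, (N <= n)%N -> nrm (l - x n) < e.
Proof.
move=> h; have : cvg (x @ \oo).
  apply: cauchy_cvg; apply: cauchy_exP => _ /posCP[e e0 ->].
  have [N hN] := h _ e0; exists (x N); exists N => // n /= Nn.
  by rewrite -ball_normE /ball_ /= ball_nrm; exact: hN.
move=> /cvg_ex[l /cvg_nrm hl]; exists l => e e0.
by have [N _ hN] := hl _ e0; exists N => n; exact: hN.
Qed.

Section Operators.
Context {R : realType} {E F : hilbertType R}.

Lemma bounded_continuous (T : E -> F) (M : R) :
  (forall x y, nrm (T x - T y) <= M * nrm (x - y)) -> continuous T.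
Proof.
move=> h x; apply/cvg_nrm => e e0.
have M0 : 0 < `|M| + 1 by rewrite ltr_wpDl.
have : 0 < e / (`|M| + 1) by rewrite divr_gt0.
have /cvg_nrm cx := @cvg_id _ (nbhs x).
move=> /cx; apply: filterS => y hy.
apply: le_lt_trans (h _ _) _; move: hy; rewrite ltr_pdivlMr// mulrC => /le_lt_trans; apply.
by rewrite ler_wpM2r ?nrm_ge0// (le_trans (ler_norm M)) ?lerDl.
Qed.

Lemma linD (T : E -> F) : linear T -> forall x y, T (x + y) = T x + T y.
Proof. by move=> lT x y; have := lT 1 x y; rewrite !scale1r. Qed.
Lemma lin0 (T : E -> F) : linear T -> T 0 = 0.
Proof. by move=> lT; apply: (addrI (T 0)); rewrite -linD// !addr0. Qed.
Lemma linZ (T : E -> F) : linear T -> forall a x, T (a *: x) = a *: T x.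
Proof. by move=> lT a x; have := lT a x 0; rewrite lin0// !addr0. Qed.
Lemma linB (T : E -> F) : linear T -> forall x y, T (x - y) = T x - T y.
Proof. by move=> lT x y; rewrite linD// -scaleN1r linZ// scaleN1r. Qed.
Lemma lin_sum (T : E -> F) : linear T -> forall (I : Type) (r : seq I) (P : pred I) f,
  T (\sum_(i <- r | P i) f i) = \sum_(i <- r | P i) T (f i).
Proof. by move=> lT I r P f; exact: (big_morph T (linD lT) (lin0 lT)). Qed.
End Operators.

Section BoundedOp.
Context {R : realType} {E : hilbertType R}.

Lemma bounded_opP (T : E -> E) :
  bounded_op T <->
  linear T /\ exists2 M : R, 0 <= M & forall x, nrm (T x) <= M * nrm x.
Proof.
split=> [[lT cT]|[lT [M M0 hM]]]; last first.
  split=> //; apply: (@bounded_continuous _ _ _ T M) => x y.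
  by rewrite -linB.
split=> //.
have /continuous_nrm/(_ 1 ltr01) := cT 0; rewrite lin0//.
move=> /nbhs_ballP[_ /posCP[d d0 ->]] hd.
exists (2 / d) => [|x]; first by rewrite divr_ge0// ltW.
have [x0|x0] := eqVneq (nrm x) 0; first by rewrite (nrm_eq0 x0) lin0// !nrm0 mulr0.
have nx : 0 < nrm x by rewrite lt_neqAle eq_sym x0 nrm_ge0.
pose k := d / (2 * nrm x).
have k0 : 0 < k by rewrite divr_gt0// mulr_gt0.
have := hd (k%:C *: x); rewrite -ball_normE /ball_ /= ball_nrm !sub0r !nrmN.
rewrite linZ// !nrmZ nrm_real gtr0_norm// => /(_ _).
have kd : k * nrm x < d.
  have -> : k * nrm x = d / 2 by rewrite /k; field; rewrite x0.
  by rewrite ltr_pdivrMr//; have := d0; lra.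
move=> /(_ kd) h; apply: ltW; rewrite -(ltr_pM2l k0) (lt_le_trans h)//.
by rewrite /k le_eqVlt; apply/orP; left; apply/eqP; field; rewrite x0 gt_eqF.
Qed.
End BoundedOp.

Section Projection.
Context {R : realType} {E : hilbertType R}.
Implicit Types (M : set E) (x y : E).

Definition closed_subspace M : Prop :=
  [/\ M 0, forall (a : R[i]) x y, M x -> M y -> M (a *: x + y)
    & forall x, (forall e : R, 0 < e -> exists2 y, M y & nrm (x - y) < e) -> M x].

Section Sub.
Context {M : set E} (cM : closed_subspace M).
Lemma csZ a x : M x -> M (a *: x).
Proof. by case: cM => M0 + _ Mx => /(_ a x 0 Mx M0); rewrite addr0. Qed.
Lemma csD x y : M x -> M y -> M (x + y).
Proof. by case: cM => M0 + _ Mx My => /(_ 1 x y Mx My); rewrite scale1r. Qed.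
Lemma csN x : M x -> M (- x).
Proof. by move=> Mx; rewrite -scaleN1r; exact: csZ. Qed.
Lemma csB x y : M x -> M y -> M (x - y).
Proof. by move=> Mx My; apply: csD => //; exact: csN. Qed.
End Sub.

Lemma inv_lt (e : R) : 0 < e -> exists N : nat, forall n, (N <= n)%N -> n.+1%:R^-1 < e.
Proof.
move=> e0; exists (Num.truncn e^-1) => n hn.
rewrite invf_plt ?posrE//; apply: lt_le_trans (_ : (Num.truncn e^-1).+1%:R <= _).
  exact: truncnS_gt.
by rewrite ler_nat.
Qed.

(** Compare with the point s <u|m> m for small s > 0: to first order in s the
    squared distance changes by -2s|<u|m>|^2. *)
Lemma inner0_of_min (u m : E) :
  (forall a : R[i], nrm u <= nrm (u - a *: m)) -> inner u m = 0.
Proof.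
move=> hmin; apply: nrm_eq0; apply/eqP; rewrite -sqrf_eq0; apply/eqP.
set c := inner u m.
have key (s : R) : nrm (u - (s%:C * c) *: m) ^+ 2 =
    nrm u ^+ 2 - 2 * s * nrm c ^+ 2 + s ^+ 2 * nrm c ^+ 2 * nrm m ^+ 2.
  rewrite [LHS]nrm_sqr !(innerBl, innerBr, innerZl, innerZr) (inner_conj u m) -/c.
  rewrite !inner_nrm; have := mulc_conj c; case: c => c1 c2 /= /(congr1 (@complex.Re R)) /= <-.
  ring.
(* a coefficient with s |m|^2 < 1, so that the quadratic term cannot compensate *)
pose s := (1 + nrm m ^+ 2)^-1.
have s0 : 0 < s by rewrite invr_gt0 ltr_pwDl// sqr_ge0.
have sm : s * nrm m ^+ 2 < 1.
  by rewrite mulrC ltr_pdivrMr ?ltr_pwDl ?sqr_ge0// mul1r ltrDr.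
clearbody s; have := hmin (s%:C * c).
rewrite -(@ler_pXn2r _ 2) ?nnegrE ?nrm_ge0// key => h.
apply/eqP; rewrite eq_le sqr_ge0 andbT leNgt; apply/negP => c0.
have : 0 < nrm c ^+ 2 * s * (2 - s * nrm m ^+ 2).
  apply: mulr_gt0; first exact: mulr_gt0.
  by move: sm; set sm := s * _; lra.
move: h c0; set C := nrm c ^+ 2; set B := nrm m ^+ 2; set A := nrm u ^+ 2 => h c0 h'.
by lra.
Qed.

(** By the parallelogram identity every minimizing sequence for the distance
    from x to M is a Cauchy sequence; its limit p minimizes the distance, so
    that x - p is orthogonal to M. *)
Lemma exists_proj M x : closed_subspace M ->
  exists2 p, M p & forall m, M m -> inner (x - p) m = 0.
Proof.
move=> cM; have [M0 _ Mc] := cM.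
pose D := [set r : R | exists2 m, M m & r = nrm (x - m)].
have lbD : has_inf D.
  split; first by exists (nrm (x - 0)), 0.
  by exists 0 => _ [m _ ->]; exact: nrm_ge0.
pose d := inf D.
have dm m : M m -> d <= nrm (x - m) by move=> Mm; apply: ge_inf; [case: lbD|exists m].
have d0 : 0 <= d by apply: lb_le_inf; [case: lbD | move=> _ [m _ ->]; exact: nrm_ge0].
have /choice[y hy] : forall n : nat, exists y, M y /\ nrm (x - y) < d + n.+1%:R^-1.
  move=> n; have [|_ [m Mm ->] hm] := @inf_adherent _ D n.+1%:R^-1 _ lbD.
    by rewrite invr_gt0.
  by exists m.
have ydist n m (e : R) : 0 <= e -> nrm (x - y n) <= d + e -> nrm (x - y m) <= d + e ->
    nrm (y n - y m) ^+ 2 <= 8 * d * e + 4 * e ^+ 2.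
  move=> e0 hn hm.
  have := parallelogram (x - y n) (x - y m).
  have -> : x - y n - (x - y m) = - (y n - y m) by rewrite !opprB addrC subrKA.
  rewrite nrmN.
  pose h : R[i] := (2^-1)%:C.
  have hh : h + h = 1 by rewrite -rmorphD /= -mulr2n -[X in X *+ 2]mul1r -mulrnAr -mulr_natr mulVf ?mulr1.
  have -> : x - y n + (x - y m) = (2 : R)%:C *: (x - (h *: y n + h *: y m)).
    rewrite scalerBr scalerDr !scalerA -!rmorphM /= divff ?pnatr_eq0// !scale1r.
    by rewrite rmorphMn /= rmorph1 scaler_nat mulr2n opprD addrACA.
  have Mh : M (h *: y n + h *: y m) by apply: csD => //; apply: csZ => //; case: (hy n); case: (hy m).
  rewrite nrmZ nrm_real gtr0_norm// exprMn.
  have := dm _ Mh; set w := nrm (x - _) => dw.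
  have dw2 : d ^+ 2 <= w ^+ 2 by rewrite ler_pXn2r ?nnegrE ?nrm_ge0.
  have hn2 : nrm (x - y n) ^+ 2 <= (d + e) ^+ 2 by rewrite ler_pXn2r ?nnegrE ?nrm_ge0 ?addr_ge0.
  have hm2 : nrm (x - y m) ^+ 2 <= (d + e) ^+ 2 by rewrite ler_pXn2r ?nnegrE ?nrm_ge0 ?addr_ge0.
  have he : (d + e) ^+ 2 = d ^+ 2 + 2 * (d * e) + e ^+ 2 by ring.
  move: dw2 hn2 hm2; rewrite he.
  have lin (a b c k A B C : R) : B <= C -> a <= B + 2 * k + A -> b <= B + 2 * k + A ->
    2 ^+ 2 * C + c = 2 * a + 2 * b -> c <= 8 * k + 4 * A by lra.
  by move=> h1 h2 h3 h4; rewrite -mulrA; apply: lin h1 h2 h3 h4.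
have hdn N n : (N <= n)%N -> nrm (x - y n) <= d + N.+1%:R^-1.
  move=> Nn; apply/ltW; apply: lt_le_trans (proj2 (hy n)) _.
  by rewrite lerD2l lef_pV2 ?posrE// ler_nat.
have [e e0|p hp] := @seq_complete _ E y.
  (* for t < e' one has 8dt + 4t^2 <= (8d + 4)t < e^2 *)
  pose e' : R := Num.min 1 (e ^+ 2 / (2 * (8 * d + 4))).
  have D0 : 0 < 8 * d + 4 by lra.
  have e'0 : 0 < e' by rewrite lt_min ltr01 divr_gt0 ?exprn_gt0 ?mulr_gt0.
  have [N hN] := inv_lt e'0; exists N => n m Nn Nm.
  rewrite -(@ltr_pXn2r _ 2) ?nnegrE ?nrm_ge0 ?ltW//.
  apply: le_lt_trans (ydist n m N.+1%:R^-1 _ (hdn _ _ Nn) (hdn _ _ Nm)) _.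
    by rewrite invr_ge0.
  have := hN _ (leqnn N); set t := _^-1 => ht.
  have t0 : 0 < t by rewrite invr_gt0.
  have t1 : t < 1 by apply: lt_le_trans ht _; rewrite ge_min lexx.
  have te : t * (8 * d + 4) < e ^+ 2.
    have : t < e ^+ 2 / (2 * (8 * d + 4)) by apply: lt_le_trans ht _; rewrite ge_min lexx orbT.
    rewrite ltr_pdivlMr ?mulr_gt0// mulrCA; apply: le_lt_trans.
    by rewrite ler_peMl ?ler1n// mulr_ge0 ?ltW.
  apply: le_lt_trans te; rewrite mulrDr (mulrC t) lerD2l mulrC.
  by rewrite ler_pM2r// expr2 ger_pMr// ltW.
have Mp : M p.
  by apply: Mc => e /hp[N hN]; exists (y N); [case: (hy N)|exact: hN].
exists p => // m Mm; apply: inner0_of_min => a.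
have -> : x - p - a *: m = x - (p + a *: m) by rewrite opprD addrA.
apply: le_trans _ (dm _ (csD cM Mp (csZ cM a Mm))).
apply/ler_addgt0Pr => e e0.
have e2 : 0 < e / 2 by rewrite divr_gt0.
have [N hN] := hp _ e2; have [N' hN'] := inv_lt e2.
pose n := maxn N N'.
have := nrm_dist x (y n) p; rewrite (nrmB (y n)); have := hN n (leq_maxl _ _).
have := proj2 (hy n); have := hN' n (leq_maxr _ _).
have lin (a0 b c i e' : R) : i < e' / 2 -> b < d + i -> c < e' / 2 ->
  a0 <= b + c -> a0 <= d + e' by lra.
exact: lin.
Qed.

Definition oproj M x : E := xget 0 [set p | M p /\ forall m, M m -> inner (x - p) m = 0].

Section Proj.
Context {M : set E} (cM : closed_subspace M).

Lemma projP x : M (oproj M x) /\ forall m, M m -> inner (x - oproj M x) m = 0.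
Proof.
rewrite /oproj; case: xgetP => [y _ [] *|h]; first by [].
by have [p Mp hp] := exists_proj x cM; case: (h p).
Qed.
Lemma proj_in x : M (oproj M x). Proof. by case: (projP x). Qed.
Lemma proj_orth x m : M m -> inner (x - oproj M x) m = 0. Proof. by case: (projP x) => _; apply. Qed.
Lemma proj_orthr x m : M m -> inner m (x - oproj M x) = 0.
Proof. by move=> Mm; rewrite inner_conj proj_orth// rmorph0. Qed.
Lemma proj_uniq x p : M p -> (forall m, M m -> inner (x - p) m = 0) -> oproj M x = p.
Proof.
move=> Mp hp; apply/eqP; rewrite -subr_eq0; apply/eqP/inner_eq0.
have Md : M (oproj M x - p) by apply: csB => //; exact: proj_in.
rewrite -[X in inner X _](subrKA x) -opprB innerDl innerNl proj_orth// hp//.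
by rewrite oppr0 addr0.
Qed.
Lemma proj_id x : M x -> oproj M x = x.
Proof. by move=> Mx; apply: proj_uniq => // m _; rewrite subrr inner0l. Qed.
Lemma proj_linear : linear (oproj M).
Proof.
move=> a x y; apply: proj_uniq => [|m Mm].
  by apply: csD => //; [apply: csZ => //|]; exact: proj_in.
rewrite opprD addrACA -scalerBr innerDl innerZl !proj_orth//.
by rewrite mulr0 addr0.
Qed.
Lemma inner_projl x y : M y -> inner (oproj M x) y = inner x y.
Proof.
by move=> My; apply/esym/eqP; rewrite -subr_eq0 -innerBl proj_orth.
Qed.
Lemma inner_projr x y : M x -> inner x (oproj M y) = inner x y.
Proof. by move=> Mx; rewrite inner_conj inner_projl// -inner_conj. Qed.
Lemma proj_sym x y : inner (oproj M x) y = inner x (oproj M y).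
Proof. by rewrite -inner_projr ?inner_projl//; exact: proj_in. Qed.
Lemma proj_nrm x : nrm (oproj M x) <= nrm x.
Proof.
rewrite -(@ler_pXn2r _ 2) ?nnegrE ?nrm_ge0//.
rewrite -[X in _ <= nrm X ^+ 2](subrK (oproj M x)) addrC pythagoras ?lerDl ?sqr_ge0//.
by rewrite proj_orthr//; exact: proj_in.
Qed.
End Proj.
End Projection.

Section Riesz.
Context {R : realType} {E : hilbertType R}.

(** The functional vanishes on a closed hyperplane and is therefore a multiple
    of the inner product with a vector orthogonal to it. *)
Lemma riesz (f : E -> R[i]) (M : R) :
  (forall (a : R[i]) x y, f (a *: x + y) = a * f x + f y) ->
  (forall x, nrm (f x) <= M * nrm x) -> exists y, forall x, f x = inner x y.
Proof.
move=> lf bf.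
have f0 : f 0 = 0.
  apply: nrm_eq0; apply/eqP; rewrite eq_le nrm_ge0 andbT.
  by rewrite (le_trans (bf 0))// nrm0 mulr0.
have fZ a x : f (a *: x) = a * f x by have := lf a x 0; rewrite f0 !addr0.
have fB x y : f (x - y) = f x - f y by rewrite addrC -scaleN1r lf mulN1r addrC.
have cN : closed_subspace [set x | f x = 0].
  split=> //= [a x y fx fy|x hx]; first by rewrite lf fx fy mulr0 addr0.
  rewrite -[f x]subr0; apply/eqP; rewrite subr_eq0; apply/eqP/nrm_sep => e e0.
  have e1 : 0 < e / (`|M| + 1) by rewrite divr_gt0// ltr_wpDl.
  have [y fy] := hx _ e1; rewrite ltr_pdivlMr ?ltr_wpDl// mulrC => h.
  rewrite -fy -fB; apply: le_lt_trans (bf _) _; apply: le_lt_trans h.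
  by rewrite ler_wpM2r ?nrm_ge0// (le_trans (ler_norm M)) ?lerDl.
have [h|] := pselect (forall x, f x = 0).
  by exists 0 => x; rewrite h inner0r.
move=> /existsNP[x0 fx0].
pose u := x0 - oproj [set x | f x = 0] x0.
have fu : f u = f x0 by rewrite fB (proj_in cN x0) subr0.
have u0 : inner u u != 0.
  apply/eqP => /inner_eq0 u0; apply: fx0; by rewrite -fu u0.
exists ((f u / inner u u)^*%C *: u) => x.
have : inner u (f u *: x - f x *: u) = 0.
  by apply: (proj_orth cN) => /=; rewrite fB !fZ mulrC subrr.
rewrite inner_conj => /(congr1 conjc); rewrite conjcK conjc0 innerBl !innerZl => /eqP.
rewrite subr_eq0 innerZr conjcK => /eqP h.
by rewrite mulrAC h mulfK.
Qed.

(** The Riesz theorem is applied in the second variable, for each value of the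
    first. *)
Lemma form_op (B : E -> E -> R[i]) (M : R) :
  (forall (a : R[i]) x x' y, B (a *: x + x') y = a * B x y + B x' y) ->
  (forall (a : R[i]) x y y', B x (a *: y + y') = a^*%C * B x y + B x y') ->
  0 <= M -> (forall x y, nrm (B x y) <= M * nrm x * nrm y) ->
  exists T : E -> E, [/\ bounded_op T, forall x y, inner (T x) y = B x y
    & forall x, nrm (T x) <= M * nrm x].
Proof.
move=> lB rB M0 bB.
have /choice[T hT] : forall x, exists t, forall y, inner t y = B x y.
  move=> x; have [a y y'|y|t ht] := @riesz (fun y => (B x y)^*%C) (M * nrm x).
  - by rewrite rB rmorphD rmorphM /= conjcK.
  - by rewrite nrm_conj.
  - by exists t => y; rewrite inner_conj -ht conjcK.
have nT x : nrm (T x) <= M * nrm x.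
  have [->|Tx] := eqVneq (nrm (T x)) 0; first by rewrite mulr_ge0// nrm_ge0.
  have := bB x (T x); rewrite -hT inner_nrm nrm_real ger0_norm ?sqr_ge0//.
  by rewrite expr2 ler_pM2r// lt_neqAle eq_sym Tx nrm_ge0.
exists T; split => //; apply/bounded_opP; split; last by exists M.
by move=> a x x'; apply: inner_ext => y; rewrite innerDl innerZl !hT lB.
Qed.

Lemma adjoint_exists (T : E -> E) : bounded_op T -> exists T', is_adjoint T T'.
Proof.
move=> /bounded_opP[lT [M M0 bT]].
have [a x x' y|a x y y'|x y|T' [bT' hT' _]] := @form_op (fun x y => inner x (T y)) M _ _ M0.
- by rewrite innerDl innerZl.
- by rewrite lT innerDr innerZr.
- by rewrite (le_trans (cauchy_schwarz _ _))// (mulrC M) -mulrA ler_wpM2l ?nrm_ge0.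
- by exists T'; split => // x y; rewrite inner_conj -hT' -inner_conj.
Qed.
End Riesz.

(** * Hilbert sums of copies of a Hilbert space *)

Section SquareSummable.
Context {R : realType} {I : choiceType} {F : hilbertType R}.
Implicit Types (f g : I -> F) (J : seq I).

Definition sqpart f J : R := \sum_(i <- J) nrm (f i) ^+ 2.

Definition sqsummable f := exists M : R, forall J, uniq J -> sqpart f J <= M.

Lemma sqpart_ge0 f J : 0 <= sqpart f J.
Proof. by apply: sumr_ge0 => i _; exact: sqr_ge0. Qed.

Lemma sqpart_sub f J J' : uniq J -> uniq J' -> {subset J <= J'} ->
  sqpart f J <= sqpart f J'.
Proof.
move=> uJ uJ' sJ; rewrite /sqpart [leRHS](bigID (mem J)) /= -[X in _ <= X + _]big_filter.
have pJ : perm_eq J [seq i <- J' | i \in J].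
  apply: uniq_perm; rewrite ?filter_uniq// => i; rewrite mem_filter.
  by apply/idP/andP => [iJ|[]//]; split => //; exact: sJ.
rewrite (perm_big _ pJ) /=.
by rewrite lerDl sumr_ge0// => i _; exact: sqr_ge0.
Qed.

Lemma sqpartZ a f J : sqpart (fun i => a *: f i) J = nrm a ^+ 2 * sqpart f J.
Proof. by rewrite /sqpart mulr_sumr; apply: eq_bigr => i _; rewrite nrmZ exprMn. Qed.

(** The finite Minkowski inequality, from ab(x+y)^2 <= (a+b)(bx^2+ay^2). *)
Lemma sqpartD f g J (a b : R) : 0 < a -> 0 < b ->
  sqpart f J <= a ^+ 2 -> sqpart g J <= b ^+ 2 ->
  sqpart (fun i => f i + g i) J <= (a + b) ^+ 2.
Proof.
move=> a0 b0 hf hg.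
have ab : 0 < a * b by exact: mulr_gt0.
rewrite -(ler_pM2l ab).
apply: (@le_trans _ _ ((a + b) * (b * sqpart f J + a * sqpart g J))).
  rewrite /sqpart !mulr_sumr -big_split mulr_sumr /=.
  apply: ler_sum => i _.
  apply: (@le_trans _ _ (a * b * (nrm (f i) + nrm (g i)) ^+ 2)).
    by rewrite ler_pM2l// ler_pXn2r ?nnegrE ?addr_ge0 ?nrm_ge0// nrmD.
  rewrite -subr_ge0; set x := nrm _; set y := nrm _.
  have -> : (a + b) * (b * x ^+ 2 + a * y ^+ 2) - a * b * (x + y) ^+ 2 =
    (a * y - b * x) ^+ 2 by ring.
  exact: sqr_ge0.
have -> : a * b * (a + b) ^+ 2 = (a + b) * (b * a ^+ 2 + a * b ^+ 2) by ring.
rewrite ler_pM2l ?addr_gt0// lerD// ler_pM2l//.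
Qed.

Lemma sqsummableD f g : sqsummable f -> sqsummable g ->
  sqsummable (fun i => f i + g i).
Proof.
move=> [M hM] [N hN].
exists ((1 + Num.sqrt (Num.max M 0) + (1 + Num.sqrt (Num.max N 0))) ^+ 2) => J uJ.
have aux (K : R) : K <= (1 + Num.sqrt (Num.max K 0)) ^+ 2.
  have K0 : 0 <= Num.max K 0 by rewrite le_max lexx orbT.
  apply: (@le_trans _ _ (Num.max K 0)); first by rewrite le_max lexx.
  rewrite -[leLHS]sqr_sqrtr// ler_pXn2r ?nnegrE ?addr_ge0 ?sqrtr_ge0//.
  by rewrite lerDr.
have pos (K : R) : 0 < 1 + Num.sqrt (Num.max K 0) by rewrite ltr_pwDl ?sqrtr_ge0.
by apply: sqpartD => //; [apply: le_trans (hM _ uJ) _|apply: le_trans (hN _ uJ) _].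
Qed.

Lemma sqsummableZ a f : sqsummable f -> sqsummable (fun i => a *: f i).
Proof.
move=> [M hM]; exists (nrm a ^+ 2 * M) => J uJ.
by rewrite sqpartZ ler_wpM2l ?sqr_ge0// hM.
Qed.

Lemma sqsummableN f : sqsummable f -> sqsummable (fun i => - f i).
Proof.
move=> /(sqsummableZ (-1)).
by rewrite (_ : (fun i => _) = (fun i => - f i))//; apply/funext => i; rewrite scaleN1r.
Qed.

Lemma sqsummable0 : sqsummable (fun=> 0).
Proof. by exists 0 => J _; rewrite /sqpart big1// => i _; rewrite nrm0 expr0n. Qed.

End SquareSummable.

(** The index set may be uncountable: for the induced representation it is the
    set of cosets of H0. *)
Record ell2 (R : realType) (I : choiceType) (F : hilbertType R) :=
  Ell2 { ell2_fun :> I -> F; ell2P : sqsummable ell2_fun }.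

HB.instance Definition _ R I F := gen_eqMixin (@ell2 R I F).
HB.instance Definition _ R I F := gen_choiceMixin (@ell2 R I F).

Section Ell2.
Context {R : realType} {I : choiceType} {F : hilbertType R}.
Local Notation L := (@ell2 R I F).
Implicit Types (f g : L) (J : seq I).

Lemma ell2_eq f g : (forall i, f i = g i) -> f = g.
Proof.
case: f g => [f hf] [g hg] /= /funext fg; move: hf hg; rewrite fg => hf hg.
by congr Ell2; exact: Prop_irrelevance.
Qed.

Definition ell2_add f g : L := Ell2 (sqsummableD (ell2P f) (ell2P g)).
Definition ell2_opp f : L := Ell2 (sqsummableN (ell2P f)).
Definition ell2_0 : L := Ell2 sqsummable0.
Definition ell2_scale a f : L := Ell2 (sqsummableZ a (ell2P f)).

Lemma ell2_addA : associative ell2_add.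
Proof. by move=> f g h; apply: ell2_eq => i /=; rewrite addrA. Qed.
Lemma ell2_addC : commutative ell2_add.
Proof. by move=> f g; apply: ell2_eq => i /=; rewrite addrC. Qed.
Lemma ell2_add0 : left_id ell2_0 ell2_add.
Proof. by move=> f; apply: ell2_eq => i /=; rewrite add0r. Qed.
Lemma ell2_addN : left_inverse ell2_0 ell2_opp ell2_add.
Proof. by move=> f; apply: ell2_eq => i /=; rewrite addNr. Qed.
HB.instance Definition _ :=
  GRing.isZmodule.Build L ell2_addA ell2_addC ell2_add0 ell2_addN.

Lemma ell2_scaleA a b f : ell2_scale a (ell2_scale b f) = ell2_scale (a * b) f.
Proof. by apply: ell2_eq => i /=; rewrite scalerA. Qed.
Lemma ell2_scale1 : left_id 1 ell2_scale.
Proof. by move=> f; apply: ell2_eq => i /=; rewrite scale1r. Qed.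
Lemma ell2_scaleDr : right_distributive ell2_scale +%R.
Proof. by move=> a f g; apply: ell2_eq => i /=; rewrite scalerDr. Qed.
Lemma ell2_scaleDl f : {morph ell2_scale^~ f : a b / a + b}.
Proof. by move=> a b; apply: ell2_eq => i /=; rewrite scalerDl. Qed.
HB.instance Definition _ := GRing.Zmodule_isLmodule.Build R[i] L
  ell2_scaleA ell2_scale1 ell2_scaleDr ell2_scaleDl.

Lemma ell2BE f g i : (f - g) i = f i - g i. Proof. by []. Qed.

(** The supremum of the finite partial sums is the unordered sum of the squared
    norms. *)
Definition sqsum f : R := sup [set r | exists2 J, uniq J & r = sqpart f J].

Lemma sqsum_has_sup f : has_sup [set r | exists2 J, uniq J & r = sqpart f J].
Proof.
split; first by exists (sqpart f [::]), [::].
by have [M hM] := ell2P f; exists M => _ [J uJ ->]; exact: hM.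
Qed.

Lemma sqpart_le f J : uniq J -> sqpart f J <= sqsum f.
Proof. by move=> uJ; apply: ub_le_sup; [case: (sqsum_has_sup f)|exists J]. Qed.

Lemma sqsum_le f (M : R) : (forall J, uniq J -> sqpart f J <= M) -> sqsum f <= M.
Proof.
by move=> h; apply: ge_sup => [|_ [J uJ ->]]; [case: (sqsum_has_sup f)|exact: h].
Qed.

Lemma sqsum_ge0 f : 0 <= sqsum f.
Proof. by apply: le_trans (sqpart_le f (J:=[::]) _); rewrite ?sqpart_ge0. Qed.

Definition ell2_nrm f : R := Num.sqrt (sqsum f).

Lemma ell2_nrm_ge0 f : 0 <= ell2_nrm f. Proof. exact: sqrtr_ge0. Qed.

Lemma ell2_nrm2 f : ell2_nrm f ^+ 2 = sqsum f.
Proof. by rewrite sqr_sqrtr ?sqsum_ge0. Qed.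

Lemma ell2_nrm_le f (M : R) : 0 <= M ->
  (forall J, uniq J -> sqpart f J <= M ^+ 2) -> ell2_nrm f <= M.
Proof.
move=> M0 h; rewrite -(@ler_pXn2r _ 2) ?nnegrE ?ell2_nrm_ge0//.
by rewrite ell2_nrm2 sqsum_le.
Qed.

Lemma ell2_nrm_coord f i : nrm (f i) <= ell2_nrm f.
Proof.
rewrite -(@ler_pXn2r _ 2) ?nnegrE ?ell2_nrm_ge0 ?nrm_ge0// ell2_nrm2.
by have := @sqpart_le f [:: i] isT; rewrite /sqpart big_seq1.
Qed.

Lemma ell2_nrmD f g : ell2_nrm (f + g) <= ell2_nrm f + ell2_nrm g.
Proof.
apply/ler_addgt0Pr => e e0.
have e2 : 0 < e / 2 by rewrite divr_gt0.
have -> : ell2_nrm f + ell2_nrm g + e = (ell2_nrm f + e / 2) + (ell2_nrm g + e / 2).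
  by rewrite addrACA -splitr.
have pos h : 0 < ell2_nrm h + e / 2 by rewrite ltr_wpDl ?ell2_nrm_ge0.
apply: ell2_nrm_le => [|J uJ]; first by rewrite addr_ge0// ltW.
by apply: sqpartD => //; apply: le_trans (sqpart_le _ uJ) _;
  rewrite -ell2_nrm2 ler_pXn2r ?nnegrE ?ell2_nrm_ge0 1?ltW// ltrDl.
Qed.

Lemma ell2_nrmZ a f : ell2_nrm (a *: f) = nrm a * ell2_nrm f.
Proof.
have le b g : ell2_nrm (b *: g) <= nrm b * ell2_nrm g.
  apply: ell2_nrm_le => [|J uJ]; first by rewrite mulr_ge0 ?nrm_ge0 ?ell2_nrm_ge0.
  by rewrite sqpartZ exprMn ler_wpM2l ?sqr_ge0// ell2_nrm2 sqpart_le.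
apply/eqP; rewrite eq_le le /=.
have [->|a0] := eqVneq a 0; first by rewrite nrm0 mul0r ell2_nrm_ge0.
have na : 0 < nrm a.
  by rewrite lt_neqAle nrm_ge0 andbT eq_sym; apply: contra_neq a0 => /nrm_eq0.
have := le a^-1 (a *: f); rewrite scalerA mulVf// scale1r => h.
rewrite -ler_pdivlMl//; apply: le_trans h _.
have -> : nrm a^-1 = (nrm a)^-1; last by [].
apply: (mulfI (lt0r_neq0 na)); rewrite -nrmM divff// mulfV ?lt0r_neq0//.
by have := @nrm_real R 1; rewrite normr1.
Qed.

Lemma ell2_nrm_eq0 f : ell2_nrm f = 0 -> f = 0.
Proof.
move=> h; apply: ell2_eq => i; apply: nrm_eq0; apply/eqP.
by rewrite eq_le nrm_ge0 -h ell2_nrm_coord.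
Qed.

Definition ell2_norm f : R[i] := (ell2_nrm f)%:C.
Lemma ell2_normD f g : ell2_norm (f + g) <= ell2_norm f + ell2_norm g.
Proof. by rewrite /ell2_norm -rmorphD lecR ell2_nrmD. Qed.
Lemma ell2_normZ a f : ell2_norm (a *: f) = `|a| * ell2_norm f.
Proof. by rewrite /ell2_norm ell2_nrmZ rmorphM nrmE. Qed.
Lemma ell2_norm_eq0 f : ell2_norm f = 0 -> f = 0.
Proof. by move=> /complexI/ell2_nrm_eq0. Qed.
HB.instance Definition _ := Lmodule_isNormed.Build R[i] L
  ell2_normD ell2_normZ ell2_norm_eq0.

Lemma ell2_nrmE f : nrm f = ell2_nrm f. Proof. by []. Qed.
End Ell2.

Section Net.
Context {R : realType} {I : choiceType}.
Implicit Types (u v : seq I -> R[i]) (J : seq I).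

(** Convergence along the net of finite subsets of I, which is how the inner
    product of two elements of the Hilbert sum is summed. *)
Definition netlim u (l : R[i]) := forall e : R, 0 < e ->
  exists J0, forall J, uniq J -> {subset J0 <= J} -> nrm (l - u J) < e.

Lemma netlim_uniq u l l' : netlim u l -> netlim u l' -> l = l'.
Proof.
move=> h h'; apply: nrm_sep => e e0.
have e2 : 0 < e / 2 by rewrite divr_gt0.
have [J1 h1] := h _ e2; have [J2 h2] := h' _ e2.
pose J := undup (J1 ++ J2).
have := h1 J (undup_uniq _) _; have := h2 J (undup_uniq _) _.
rewrite (nrmB l' (u J)) => H2 H1.
rewrite (le_lt_trans (nrm_dist _ (u J) _))// [ltRHS]splitr ltrD//.
  by apply: H1 => i iJ; rewrite mem_undup mem_cat iJ.
by apply: H2 => i iJ; rewrite mem_undup mem_cat iJ orbT.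
Qed.

Lemma netlimD u v l m : netlim u l -> netlim v m ->
  netlim (fun J => u J + v J) (l + m).
Proof.
move=> h h' e e0; have e2 : 0 < e / 2 by rewrite divr_gt0.
have [J1 h1] := h _ e2; have [J2 h2] := h' _ e2.
exists (J1 ++ J2) => J uJ sJ.
rewrite opprD addrACA (le_lt_trans (nrmD _ _))// [ltRHS]splitr ltrD//.
  by apply: h1 => // i iJ; apply: sJ; rewrite mem_cat iJ.
by apply: h2 => // i iJ; apply: sJ; rewrite mem_cat iJ orbT.
Qed.

Lemma netlimM a u l : netlim u l -> netlim (fun J => a * u J) (a * l).
Proof.
move=> h e e0; have a0 : 0 < nrm a + 1 by rewrite ltr_wpDl ?nrm_ge0.
have [J0 h0] := h _ (divr_gt0 e0 a0); exists J0 => J uJ sJ.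
rewrite -mulrBr nrmM; have := h0 J uJ sJ; rewrite ltr_pdivlMr// mulrC.
by apply: le_lt_trans; rewrite ler_wpM2r ?nrm_ge0// lerDl.
Qed.

Lemma netlim_conj u l : netlim u l -> netlim (fun J => (u J)^*%C) l^*%C.
Proof.
move=> h e e0; have [J0 h0] := h _ e0; exists J0 => J uJ sJ.
by rewrite -rmorphB nrm_conj h0.
Qed.

Lemma netlim_ext u v l : (forall J, uniq J -> u J = v J) -> netlim u l -> netlim v l.
Proof.
by move=> uv h e e0; have [J0 h0] := h _ e0; exists J0 => J uJ sJ; rewrite -uv// h0.
Qed.

Lemma netlim_const u l J0 : (forall J, uniq J -> {subset J0 <= J} -> u J = l) -> netlim u l.
Proof. by move=> h e e0; exists J0 => J uJ sJ; rewrite h// subrr nrm0. Qed.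
End Net.

Section Ell2Inner.
Context {R : realType} {I : choiceType} {F : hilbertType R}.
Local Notation L := (@ell2 R I F).
Implicit Types (f g : L) (J : seq I).
Local Notation imag := (0 +i* 1)%C.

Lemma sqsum_lim f : netlim (fun J => (sqpart f J)%:C) (sqsum f)%:C.
Proof.
move=> e e0; have [_ [J0 uJ0 ->] hJ] := sup_adherent e0 (sqsum_has_sup f).
exists J0 => J uJ sJ; rewrite -rmorphB nrm_real ger0_norm ?subr_ge0 ?sqpart_le//.
have := @sqpart_sub _ _ _ f _ _ uJ0 uJ sJ; rewrite -/(sqsum f) in hJ.
by rewrite ltrBlDr -ltrBlDl => /(lt_le_trans hJ).
Qed.

Definition inner_part f g J : R[i] := \sum_(i <- J) inner (f i) (g i).
(** The real part of the inner product, by polarization; this definition makes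
    sense before any convergence is known. *)
Definition ell2_Re f g : R := (sqsum (f + g) - sqsum (f - g)) / 4.
Definition ell2_inner f g : R[i] :=
  (ell2_Re f g)%:C + imag * (ell2_Re f (imag *: g))%:C.

Lemma ell2_Re_lim f g :
  netlim (fun J => (complex.Re (inner_part f g J))%:C) (ell2_Re f g)%:C.
Proof.
have := netlimM (4^-1)%:C (netlimD (sqsum_lim (f + g)) (netlimM (-1) (sqsum_lim (f - g)))).
rewrite mulN1r -rmorphB -rmorphM /= mulrC; apply: netlim_ext => J _.
rewrite mulN1r -rmorphB -rmorphM /=; congr (_%:C).
rewrite /inner_part /sqpart -sumrB mulr_sumr (raddf_sum (@complex.Re R)) /=.
by apply: eq_bigr => i _; rewrite Re_inner mulrC.
Qed.

(** Sesquilinearity of the inner product is inherited from the finite partial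
    sums through this limit. *)
Lemma ell2_inner_lim f g : netlim (inner_part f g) (ell2_inner f g).
Proof.
have := netlimD (ell2_Re_lim f g) (netlimM imag (ell2_Re_lim f (imag *: g))).
apply: netlim_ext => J _.
have -> : complex.Re (inner_part f (imag *: g) J) = complex.Im (inner_part f g J).
  rewrite /inner_part (raddf_sum (@complex.Re R)) (raddf_sum (@complex.Im R)) /=.
  by apply: eq_bigr => i _; rewrite Im_inner.
case: (inner_part f g J) => a b; apply/eqP; rewrite eq_complex /=.
by apply/andP; split; apply/eqP; ring.
Qed.

Lemma ell2_inner_linear a f g h :
  ell2_inner (a *: f + g) h = a * ell2_inner f h + ell2_inner g h.
Proof.
apply: netlim_uniq (ell2_inner_lim _ _) _.
apply: netlim_ext (netlimD (netlimM a (ell2_inner_lim f h)) (ell2_inner_lim g h)).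
move=> J _; rewrite /inner_part mulr_sumr -big_split /=; apply: eq_bigr => i _.
by rewrite innerDl innerZl.
Qed.

Lemma ell2_inner_conj f g : ell2_inner g f = (ell2_inner f g)^*%C.
Proof.
apply: netlim_uniq (ell2_inner_lim _ _) _.
apply: netlim_ext (netlim_conj (ell2_inner_lim f g)) => J _.
by rewrite /inner_part rmorph_sum /=; apply: eq_bigr => i _; rewrite -inner_conj.
Qed.

Lemma ell2_inner_norm f : ell2_inner f f = `|f| ^+ 2.
Proof.
rewrite nrmE -rmorphXn /= ell2_nrmE ell2_nrm2.
apply: netlim_uniq (ell2_inner_lim _ _) _.
apply: netlim_ext (sqsum_lim f) => J _.
by rewrite /inner_part /sqpart rmorph_sum; apply: eq_bigr => i _; rewrite inner_nrm.
Qed.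

(** The coordinates converge; the rate of convergence passes to the limit in
    every finite partial sum, hence in the norm. *)
Lemma ell2_seq_complete (x : nat -> L) :
  (forall n m : nat, (n <= m)%N -> nrm (x n - x m) <= 2 * n.+1%:R^-1) ->
  exists f : L, forall n, nrm (f - x n) <= 4 * n.+1%:R^-1.
Proof.
move=> hx.
have /choice[f hf] : forall i, exists l, forall e : R, 0 < e ->
    exists N, forall n, (N <= n)%N -> nrm (l - x n i) < e.
  move=> i; apply: (@seq_complete R F (fun n => x n i)) => e e0.
  have e4 : 0 < e / 4 by rewrite divr_gt0.
  have [N hN] := inv_lt e4; exists N => n m Nn Nm.
  have aux k : (N <= k)%N -> nrm (x N i - x k i) < e / 2.
    move=> Nk; have := hx _ _ Nk; have := hN N (leqnn N).
    have := ell2_nrm_coord (x N - x k) i; rewrite -ell2_nrmE ell2BE.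
    move: (nrm _) (nrm _) (_^-1) => a b c; have := e0; lra.
  rewrite (le_lt_trans (nrm_dist _ (x N i) _))// [ltRHS]splitr ltrD// ?aux//.
  by rewrite nrmB aux.
have key n J : uniq J -> sqpart (fun i => f i - x n i) J <= (4 * n.+1%:R^-1) ^+ 2.
  move=> uJ; set c : R := n.+1%:R^-1; have c0 : 0 < c by rewrite invr_gt0.
  (* d is a common error for the coordinates in J, reached from the index N on *)
  have [d d0 hd] : exists2 d : R, 0 < d & (size J)%:R * d ^+ 2 <= c ^+ 2.
    exists (c / (size J).+1%:R); first by rewrite divr_gt0.
    rewrite expr_div_n mulrA ler_pdivrMr ?exprn_gt0// mulrC ler_wpM2l ?sqr_ge0//.
    by rewrite -natrX ler_nat (leq_trans (leqnSn _))// leq_pmulr.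
  have [N hN] : exists N, forall m, (N <= m)%N -> forall i, i \in J -> nrm (f i - x m i) < d.
    elim: J {uJ hd} => [|i J [N hN]]; first by exists 0%N.
    have [N' hN'] := hf i d d0; exists (maxn N N') => m; rewrite geq_max => /andP[Nm N'm] j.
    by rewrite inE => /orP[/eqP ->|]; [exact: hN'|exact: hN].
  pose m := maxn n N.
  have hm1 : sqpart (fun i => f i - x m i) J <= c ^+ 2.
    apply: le_trans hd; apply: (@le_trans _ _ (\sum_(i <- J) d ^+ 2)).
      rewrite /sqpart big_seq [leRHS]big_seq; apply: ler_sum => i iJ.
      by rewrite ler_pXn2r ?nnegrE ?nrm_ge0 1?ltW// hN ?leq_maxr.
    by rewrite big_const_seq count_predT iter_addr_0 mulr_natl.
  have hm2 : sqpart (x m - x n) J <= (3 * c) ^+ 2.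
    apply: le_trans (sqpart_le _ uJ) _; rewrite -ell2_nrm2 -ell2_nrmE nrmB.
    rewrite ler_pXn2r ?nnegrE ?nrm_ge0 ?mulr_ge0 1?ltW//.
    apply: le_lt_trans (hx _ _ (leq_maxl _ _)) _.
    by rewrite ltr_pM2r// ltr_nat.
  have c3 : 0 < 3 * c by rewrite mulr_gt0.
  have := sqpartD c0 c3 hm1 hm2; have -> : c + 3 * c = 4 * c by ring.
  congr (_ <= _); apply: eq_bigr => i _; congr (nrm _ ^+ 2).
  by rewrite ell2BE subrKA.
have sf : sqsummable f.
  have s0 : sqsummable (fun i => f i - x 0%N i).
    by exists ((4 * 1%:R^-1) ^+ 2) => J; exact: key.
  have := sqsummableD s0 (ell2P (x 0%N)).
  by rewrite (_ : (fun i => _) = f)//; apply/funext => i; rewrite subrK.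
exists (Ell2 sf) => n; rewrite ell2_nrmE; apply: ell2_nrm_le => [|J uJ].
  by rewrite mulr_ge0.
exact: key.
Qed.

Lemma ell2_complete (G : set_system L) : ProperFilter G -> cauchy G -> cvg G.
Proof.
move=> PG /cauchyP cG.
have /choice[x hx] : forall n : nat, exists x : L, G (ball x (n.+1%:R^-1 : R)%:C).
  by move=> n; apply: cG; rewrite ltcR invr_gt0.
have [n m nm|f hf] := @ell2_seq_complete x.
  have [y [yn ym]] := filter_ex (filterI (hx n) (hx m)).
  move: yn ym; rewrite -!ball_normE /ball_ /= !ball_nrm => yn ym.
  rewrite (le_trans (nrm_dist _ y _))// mulr_natl mulr2n lerD// ?ltW//.
  rewrite nrmB (lt_le_trans ym)// lef_pV2 ?posrE// ler_nat ltnS//.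
apply/cvg_ex; exists f; apply/(@cvg_nrm R L _ G _ id) => e e0.
have e5 : 0 < e / 5 by rewrite divr_gt0.
have [N hN] := inv_lt e5; apply: filterS (hx N) => y.
rewrite -ball_normE /ball_ /= ball_nrm => h.
have := hf N; have := hN N (leqnn N); have := nrm_dist f (x N) y; move: h.
move: (nrm _) (nrm _) (nrm _) (_^-1) => a b c d; lra.
Qed.
HB.instance Definition _ := Uniform_isComplete.Build L ell2_complete.
HB.instance Definition _ := isHilbert.Build R L
  ell2_inner_linear ell2_inner_conj ell2_inner_norm.
End Ell2Inner.

(** * Weak continuity and amplifications *)

Section Delta.
Context {R : realType} {I : choiceType} {F : hilbertType R}.
Local Notation L := (@ell2 R I F).
Implicit Types (f g : L).

Lemma delta_summable (i : I) (x : F) :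
  sqsummable (fun j => if j == i then x else 0).
Proof.
exists (nrm x ^+ 2) => J uJ; rewrite /sqpart.
have [iJ|iJ] := boolP (i \in J).
  rewrite (bigD1_seq i)//= eqxx big1 ?addr0// => j /negbTE ->.
  by rewrite nrm0 expr0n.
rewrite big_seq big1 ?sqr_ge0// => j jJ; case: eqP => [ji|]; last by rewrite nrm0 expr0n.
by move: iJ; rewrite -ji jJ.
Qed.

Definition delta (i : I) (x : F) : L := Ell2 (delta_summable i x).

Lemma inner_delta f i x : inner f (delta i x) = inner (f i) x.
Proof.
apply: netlim_uniq (ell2_inner_lim _ _) _.
apply: (@netlim_const _ _ _ _ [:: i]) => J uJ sJ; rewrite /inner_part.
rewrite (bigD1_seq i) ?sJ ?inE//= eqxx big1 ?addr0// => j /negbTE ->.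
by rewrite inner0r.
Qed.

Lemma deltaE i x : delta i x i = x.
Proof. by rewrite /= eqxx. Qed.

Lemma nrm_delta i x : nrm (delta i x) = nrm x.
Proof.
apply/eqP; rewrite -(@eqrXn2 _ 2) ?nrm_ge0//.
by rewrite !nrm_sqr inner_delta deltaE.
Qed.

(** A vector orthogonal to all vectors supported at one index has zero
    coordinates. *)
Lemma delta_total (M : set L) : closed_subspace M ->
  (forall i x, M (delta i x)) -> forall f, M f.
Proof.
move=> cM hM f; suff -> : f = oproj M f by exact: (proj_in cM).
apply/eqP; rewrite -subr_eq0; apply/eqP/ell2_eq => i; apply/inner_eq0.
by rewrite -inner_delta (proj_orth cM).
Qed.

End Delta.

Lemma ell2_inner_fin (R : realType) (I : finType) (F : hilbertType R) (f g : ell2 I F) :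
  inner f g = \sum_i inner (f i) (g i).
Proof.
apply: netlim_uniq (ell2_inner_lim _ _) _.
apply: (@netlim_const _ _ _ _ (index_enum I)) => J uJ sJ.
apply: perm_big; apply: uniq_perm => //; first exact: index_enum_uniq.
by move=> i; rewrite mem_index_enum sJ// mem_index_enum.
Qed.

Lemma finite_sqsummable (R : realType) (I : finType) (F : hilbertType R) (f : I -> F) :
  sqsummable f.
Proof.
exists (sqpart f (index_enum I)) => J uJ; apply: sqpart_sub => //.
  exact: index_enum_uniq.
by move=> i _; rewrite mem_index_enum.
Qed.

Section Ccont.
Context {R : realType} {T : topologicalType}.
Implicit Types (t : T) (f g : T -> R[i]).

(** Continuity stated with real epsilons, so that estimates of nrm apply
    directly. *)
Definition ccont t f := forall e : R, 0 < e -> \forall s \near t, nrm (f t - f s) < e.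

Lemma ccontP t f : {for t, continuous (f : T -> R[i]^o)} <-> ccont t f.
Proof. exact: (@continuous_nrm R R[i]^o). Qed.

Lemma ccontD t f g : ccont t f -> ccont t g -> ccont t (fun s => f s + g s).
Proof.
move=> hf hg e e0; have e2 : 0 < e / 2 by rewrite divr_gt0.
apply: filterS2 (hf _ e2) (hg _ e2) => s h1 h2.
by rewrite opprD addrACA (le_lt_trans (nrmD _ _))// [ltRHS]splitr ltrD.
Qed.

Lemma ccontM t a f : ccont t f -> ccont t (fun s => a * f s).
Proof.
move=> hf e e0; have a0 : 0 < nrm a + 1 by rewrite ltr_wpDl ?nrm_ge0.
apply: filterS (hf _ (divr_gt0 e0 a0)) => s; rewrite ltr_pdivlMr// mulrC.
by rewrite -mulrBr nrmM; apply: le_lt_trans; rewrite ler_wpM2r ?nrm_ge0// lerDl.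
Qed.

Lemma ccont_lim t f : (forall e : R, 0 < e -> exists2 g, ccont t g &
  forall s, nrm (f s - g s) <= e) -> ccont t f.
Proof.
move=> h e e0; have e3 : 0 < e / 4 by rewrite divr_gt0.
have [g hg fg] := h _ e3; apply: filterS (hg _ e3) => s.
have := fg t; have := fg s; rewrite (nrmB (f s)).
have := nrm_dist (f t) (g t) (f s); have := nrm_dist (g t) (g s) (f s).
move: (nrm _) (nrm _) (nrm _) (nrm _) (nrm (f t - f s)) => a b c d k; lra.
Qed.

Lemma ccont_near t f g : ccont t f -> f t = g t ->
  (\forall s \near t, f s = g s) -> ccont t g.
Proof.
move=> hf ft fg e e0; rewrite -ft.
by apply: filterS2 fg (hf _ e0) => s ->.
Qed.
Lemma ccont_cst t (a : R[i]) : ccont t (fun=> a).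
Proof. by move=> e e0; apply: nearW => s; rewrite subrr nrm0. Qed.
End Ccont.

Section WeakContinuity.
Context {R : realType} {T : topologicalType} {K : hilbertType R}.

(** For a bounded family of vectors, weak continuity may be tested on a total
    set of vectors y. *)
Lemma weak_cont_closed (t : T) (a : T -> K) (C : R) : (forall s, nrm (a s) <= C) ->
  closed_subspace [set y | ccont t (fun s => inner (a s) y)].
Proof.
move=> aC; have C0 : 0 <= C by apply: le_trans (aC t); exact: nrm_ge0.
split=> /=.
- by move=> e e0; apply: nearW => s; rewrite !inner0r subrr nrm0.
- move=> k x y hx hy; apply: ccont_near (ccontD (ccontM k^*%C hx) hy) _ _.
    by rewrite innerDr innerZr.
  by apply: nearW => s; rewrite innerDr innerZr.
- move=> y hy; apply: ccont_lim => e e0.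
  have [z hz yz] := hy _ (divr_gt0 e0 (ltr_wpDl C0 ltr01)).
  exists (fun s => inner (a s) z) => // s; rewrite -innerBr.
  apply: le_trans (cauchy_schwarz _ _) _; move: yz; rewrite ltr_pdivlMr ?ltr_wpDl//.
  move=> /ltW; apply: le_trans; rewrite mulrC ler_wpM2l ?nrm_ge0//.
  by rewrite (le_trans (aC s))// lerDl.
Qed.

(** For a family of contractions, weak continuity may be tested on a total set
    of vectors x. *)
Lemma weak_cont_closedl (t : T) (sigma : T -> K -> K) :
  (forall s, linear (sigma s)) -> (forall s x, nrm (sigma s x) <= nrm x) ->
  closed_subspace [set x | forall y, ccont t (fun s => inner (sigma s x) y)].
Proof.
move=> ls bs; split=> /=.
- by move=> y e e0; apply: nearW => s; rewrite !lin0// subrr nrm0.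
- move=> k x x' hx hx' y; apply: ccont_near (ccontD (ccontM k (hx y)) (hx' y)) _ _.
    by rewrite ls innerDl innerZl.
  by apply: nearW => s; rewrite ls innerDl innerZl.
- move=> x hx y; apply: ccont_lim => e e0.
  have [z hz xz] := hx _ (divr_gt0 e0 (ltr_wpDl (nrm_ge0 y) ltr01)).
  exists (fun s => inner (sigma s z) y) => // s; rewrite -innerBl -linB//.
  apply: le_trans (cauchy_schwarz _ _) _; move: xz; rewrite ltr_pdivlMr ?ltr_wpDl ?nrm_ge0//.
  move=> /ltW; apply: le_trans; apply: ler_pM; rewrite ?nrm_ge0// lerDl//.
Qed.

(** For isometries the weak and strong topologies agree, because |Ux - Vx|^2 =
    2|x|^2 - 2 Re <Ux|Vx>. *)
Lemma weak_strong_cont (sigma : T -> K -> K) (x : K) :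
  (forall s, nrm (sigma s x) = nrm x) ->
  (forall t y, ccont t (fun s => inner (sigma s x) y)) ->
  continuous (fun s => sigma s x).
Proof.
move=> isg ws t; apply/continuous_nrm => e e0.
have e2 : 0 < e ^+ 2 / 2 by rewrite divr_gt0// exprn_gt0.
apply: filterS (ws t (sigma t x) _ e2) => s h.
rewrite -(@ltr_pXn2r _ 2) ?nnegrE ?nrm_ge0 1?ltW//.
rewrite nrm_sqr !(innerBl, innerBr) (inner_conj (sigma s x) (sigma t x)) !inner_nrm !isg.
move: (Re_le_nrm (inner (sigma t x) (sigma t x) - inner (sigma s x) (sigma t x))) h.
rewrite inner_nrm isg; case: (inner _ _) => a b /=.
move=> h1 h2; move: (le_lt_trans h1 h2) => {h1 h2}.
by move: (nrm x ^+ 2) (e ^+ 2) => m k; lra.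
Qed.
End WeakContinuity.

Section Amplification.
Context {R : realType} {G : topGroupType} {I : choiceType} {K : hilbertType R}.
Variable om : unitary_rep G K.
Local Notation L := (@ell2 R I K).

Lemma rep_nrm (s : G) x : nrm (om s x) = nrm x.
Proof.
apply/eqP; rewrite -(@eqrXn2 _ 2) ?nrm_ge0//.
by rewrite !nrm_sqr rep_inner.
Qed.

Lemma amp_summable (s : G) (f : L) : sqsummable (fun i => om s (f i)).
Proof.
have [M hM] := ell2P f; exists M => J uJ; apply: le_trans (hM _ uJ).
by rewrite /sqpart; under eq_bigr do rewrite rep_nrm.
Qed.

Definition amp_fun (s : G) (f : L) : L := Ell2 (amp_summable s f).

Lemma amp_linear s : linear (amp_fun s).
Proof. by move=> a f g; apply: ell2_eq => i; exact: rep_linear. Qed.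

Lemma amp1 f : amp_fun 1%g f = f.
Proof. by apply: ell2_eq => i; exact: rep1. Qed.

Lemma ampM s t f : amp_fun (s * t)%g f = amp_fun s (amp_fun t f).
Proof. by apply: ell2_eq => i; exact: repM. Qed.

Lemma amp_inner s f g : inner (amp_fun s f) (amp_fun s g) = inner f g.
Proof.
apply: netlim_uniq (ell2_inner_lim _ _) _.
apply: netlim_ext (ell2_inner_lim f g) => J _.
by apply: eq_bigr => i _; rewrite /= rep_inner.
Qed.

Lemma amp_nrm s f : nrm (amp_fun s f) = nrm f.
Proof.
by apply/eqP; rewrite -(@eqrXn2 _ 2) ?nrm_ge0// !nrm_sqr amp_inner.
Qed.

Lemma rep_weak_cont (t : G) x y : ccont t (fun s => inner (om s x) y).
Proof.
move=> e e0; have y0 : 0 < nrm y + 1 by rewrite ltr_wpDl ?nrm_ge0.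
have /continuous_nrm := @rep_continuous _ _ _ om x t.
move=> /(_ _ (divr_gt0 e0 y0)); apply: filterS => s.
rewrite ltr_pdivlMr// => h; rewrite -innerBl.
apply: le_lt_trans (cauchy_schwarz _ _) _; apply: le_lt_trans h.
by rewrite ler_wpM2l ?nrm_ge0// lerDl.
Qed.

Lemma amp_continuous f : continuous (fun s => amp_fun s f).
Proof.
apply: weak_strong_cont => [s|t]; first exact: amp_nrm.
apply: delta_total.
  by apply: (@weak_cont_closed _ _ _ t (fun s => amp_fun s f) (nrm f)) => s; rewrite amp_nrm.
move=> i x /=; apply: ccont_near (rep_weak_cont t (f i) x) _ _.
  by rewrite inner_delta.
by apply: nearW => s; rewrite inner_delta.
Qed.

Definition amplification : unitary_rep G L :=
  Build_unitary_rep amp_linear amp1 ampM amp_inner amp_continuous.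
End Amplification.

(** * Induction from an open subgroup *)

Section Translations.
Context {G : topGroupType}.
Lemma lmulg_continuous (a : G) : continuous (fun s => (a * s)%g).
Proof.
move=> s.
apply: (@cvg_comp _ _ _ (fun s => (a, s)) (fun x : G * G => (x.1 * x.2)%g) _ (nbhs (a, s))).
  by apply: cvg_pair => //=; exact: cvg_cst.
exact: (@mulg_continuous G (a, s)).
Qed.
Lemma rmulg_continuous (a : G) : continuous (fun s => (s * a)%g).
Proof.
move=> s.
apply: (@cvg_comp _ _ _ (fun s => (s, a)) (fun x : G * G => (x.1 * x.2)%g) _ (nbhs (s, a))).
  by apply: cvg_pair => //=; exact: cvg_cst.
exact: (@mulg_continuous G (s, a)).
Qed.
End Translations.

Section Induced.
Context {R : realType} {H : topGroupType} {F : hilbertType R}.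
Variables (H0 : set H) (b : H -> F -> F).
Hypothesis H0_sub : is_subgroup H0.
Hypothesis H0_open : open H0.
Hypothesis b_linear : forall s, H0 s -> linear (b s).
Hypothesis b1 : forall x, b 1%g x = x.
Hypothesis bM : forall s t x, H0 s -> H0 t -> b (s * t)%g x = b s (b t x).
Hypothesis b_inner : forall s x y, H0 s -> inner (b s x) (b s y) = inner x y.
Hypothesis b_cont : forall s x y, H0 s -> ccont s (fun h => inner (b h x) y).

Let H01 : H0 1%g. Proof. by case: H0_sub. Qed.
Let H0M s t : H0 s -> H0 t -> H0 (s * t)%g. Proof. by case: H0_sub => _ + _; apply. Qed.
Let H0V s : H0 s -> H0 (s^-1)%g. Proof. by case: H0_sub => _ _; apply. Qed.
Let H0Mr s t : H0 t -> H0 (s * t)%g <-> H0 s.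
Proof.
move=> Ht; split=> [h|]; last by move=> /H0M; apply.
by have := H0M h (H0V Ht); rewrite mulgK.
Qed.
Let H0Ml s t : H0 s -> H0 (s * t)%g <-> H0 t.
Proof.
move=> Hs; split=> [h|]; last by move=> ?; exact: H0M.
by have := H0M (H0V Hs) h; rewrite mulKg.
Qed.
Let H0Vi s : H0 (s^-1)%g <-> H0 s.
Proof. by split=> [/H0V|/H0V//]; rewrite invgK. Qed.

Let b_nrm s x : H0 s -> nrm (b s x) = nrm x.
Proof.
by move=> Hs; apply/eqP; rewrite -(@eqrXn2 _ 2) ?nrm_ge0// !nrm_sqr b_inner.
Qed.

(** The choice depends only on the set, hence only on the left coset of h. *)
Definition coset_rep (h : H) : H := xget 1%g [set c | H0 (h^-1 * c)%g].

Lemma coset_repP h : H0 (h^-1 * coset_rep h)%g.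
Proof.
rewrite /coset_rep; case: xgetP => [y _ //|/(_ h)].
by rewrite /= mulVg => /(_ H01).
Qed.

Lemma coset_repM h k : H0 k -> coset_rep (h * k)%g = coset_rep h.
Proof.
move=> Hk; rewrite /coset_rep; congr xget; apply/seteqP.
have iff c := @H0Ml k^-1%g (h^-1 * c)%g (H0V Hk).
by split=> c /=; rewrite invgM -mulgA => /iff.
Qed.

Lemma coset_rep_eq h h' : H0 (h^-1 * h')%g -> coset_rep h = coset_rep h'.
Proof. by move=> /(coset_repM h); rewrite mulVKg. Qed.

Lemma coset_repK h : coset_rep (coset_rep h) = coset_rep h.
Proof. by apply/esym/coset_rep_eq/coset_repP. Qed.

Lemma coset_rep_inj h h' : coset_rep h = coset_rep h' -> H0 (h^-1 * h')%g.
Proof.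
move=> hh'; have := H0M (coset_repP h) (H0V (coset_repP h')).
by rewrite hh' invgM invgK mulgA mulgK.
Qed.

Local Notation I := {c : H | coset_rep c == c}.
Definition coset_idx (h : H) : I := exist _ (coset_rep h) (introT eqP (coset_repK h)).

Lemma coset_idx_val (c : I) : coset_idx (val c) = c.
Proof. by apply/val_inj/eqP; exact: (valP c). Qed.

Lemma coset_idxP h (c : I) : coset_idx h = c <-> H0 (h^-1 * val c)%g.
Proof.
split=> [<-|hc]; first exact: coset_repP.
by rewrite -[RHS]coset_idx_val; apply/val_inj/coset_rep_eq.
Qed.

Local Notation L := (@ell2 R I F).

(** A function on the representatives extends uniquely to a function f on H with
    f(hk) = b(k^-1) f(h) for k in H0; H then acts by left translation. This
    is the usual model of the induced representation, transported to
    functions on the representatives. *)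
Definition equiv_ext (f : I -> F) (h : H) : F :=
  b (h^-1 * coset_rep h)%g (f (coset_idx h)).

Lemma equiv_extM f h k : H0 k -> equiv_ext f (h * k)%g = b (k^-1)%g (equiv_ext f h).
Proof.
move=> Hk; rewrite /equiv_ext -bM; [|exact: H0V|exact: coset_repP].
rewrite coset_repM// mulgA -invgM; congr (b _ (f _)).
by apply: val_inj; exact: coset_repM.
Qed.

Lemma equiv_ext_val f (c : I) : equiv_ext f (val c) = f c.
Proof.
rewrite /equiv_ext coset_idx_val (eqP (valP c) : coset_rep (val c) = _).
by rewrite mulVg b1.
Qed.

(** Left translation permutes the cosets and b is isometric, so a finite partial
    sum of the translate is a finite partial sum of the original function. *)
Lemma induced_summable (s : H) (f : L) :
  sqsummable (fun c : I => equiv_ext f (s^-1 * val c)%g).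
Proof.
have [M hM] := ell2P f; exists M => J uJ.
pose tau (c : I) := coset_idx (s^-1 * val c)%g.
have utau : uniq (map tau J).
  rewrite map_inj_uniq// => c d /(congr1 val)/coset_rep_inj.
  rewrite invgM invgK -mulgA mulVKg => cd.
  by rewrite -(coset_idx_val c); apply/coset_idxP.
apply: le_trans (hM _ utau); rewrite /sqpart big_map; apply: ler_sum => c _.
by rewrite /equiv_ext b_nrm//; exact: coset_repP.
Qed.

Definition induced_fun (s : H) (f : L) : L := Ell2 (induced_summable s f).

Lemma induced_linear s : linear (induced_fun s).
Proof.
by move=> a f g; apply: ell2_eq => c /=; rewrite /equiv_ext b_linear//; exact: coset_repP.
Qed.

Lemma induced1 f : induced_fun 1%g f = f.
Proof. by apply: ell2_eq => c /=; rewrite invg1 mul1g equiv_ext_val. Qed.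

Lemma inducedM s t f : induced_fun (s * t)%g f = induced_fun s (induced_fun t f).
Proof.
apply: ell2_eq => c /=; set h := (s^-1 * val c)%g.
rewrite [RHS]/equiv_ext /=; set r := coset_rep h.
have -> : ((s * t)^-1 * val c)%g = (t^-1 * r * (r^-1 * h))%g.
  by rewrite invgM -!mulgA mulVKg.
rewrite equiv_extM; first by rewrite invgM invgK.
by rewrite -H0Vi invgM invgK; exact: coset_repP.
Qed.

Lemma induced_nrm s f : nrm (induced_fun s f) = nrm f.
Proof.
have le t g : nrm (induced_fun t g) <= nrm g.
  rewrite !ell2_nrmE; apply: ell2_nrm_le => [|J uJ]; first exact: ell2_nrm_ge0.
  rewrite ell2_nrm2.
  pose tau (c : I) := coset_idx (t^-1 * val c)%g.
  have utau : uniq (map tau J).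
    rewrite map_inj_uniq// => c d /(congr1 val)/coset_rep_inj.
    rewrite invgM invgK -mulgA mulVKg => cd.
    by rewrite -(coset_idx_val c); apply/coset_idxP.
  apply: le_trans (sqpart_le g utau); rewrite /sqpart big_map; apply: ler_sum => c _.
  by rewrite /= /equiv_ext b_nrm//; exact: coset_repP.
apply/eqP; rewrite eq_le le /=.
by have := le s^-1%g (induced_fun s f); rewrite -inducedM mulVg induced1.
Qed.

(** The matrix coefficient between two cosets is a translate of b cut off to the
    open and closed set where it is supported; this is what gives the
    continuity of the induced representation. *)
Lemma induced_delta s (c d : I) x : induced_fun s (delta c x) d =
  if ((val d)^-1 * s * val c)%g \in H0 then b ((val d)^-1 * s * val c)%g x else 0.
Proof.
rewrite /= /equiv_ext /=; case: ifPn => [/eqP ec|ec].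
  have := coset_repP (s^-1 * val d)%g; move: (congr1 val ec) => /= ->.
  by rewrite invgM invgK => h; rewrite mem_set.
rewrite lin0; last by apply: b_linear; exact: coset_repP.
rewrite memNset// => h; move: ec => /eqP; apply; apply/coset_idxP.
by rewrite invgM invgK.
Qed.

Lemma induced_continuous f : continuous (fun s => induced_fun s f).
Proof.
apply: weak_strong_cont => [s|t]; first exact: induced_nrm.
move: f; apply: (@delta_total _ _ _
  [set f | forall y, ccont t (fun s => inner (induced_fun s f) y)]).
  apply: (@weak_cont_closedl _ _ _ t induced_fun induced_linear) => s x.
  by rewrite induced_nrm.
move=> c x /=; apply: (@delta_total _ _ _
  [set y | ccont t (fun s => inner (induced_fun s (delta c x)) y)]).
  apply: (@weak_cont_closed _ _ _ t _ (nrm (delta c x))) => s.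
  by rewrite induced_nrm.
move=> d y /=.
pose k (s : H) := ((val d)^-1 * s * val c)%g.
have ck : continuous k.
  move=> s; apply: (@cvg_comp _ _ _ (fun s : H => (val d)^-1 * s)%g (fun s : H => s * val c)%g _ (nbhs ((val d)^-1 * s)%g)).
    exact: lmulg_continuous.
  exact: rmulg_continuous.
have [kt|kt] := pselect (H0 (k t)).
  apply: (@ccont_near _ _ t (fun s => inner (b (k s) x) y)).
  - by move=> e e0; exact: (ck t _ (b_cont x y kt e0)).
  - by rewrite inner_delta induced_delta mem_set.
  - have : \forall s \near t, H0 (k s) by apply: (ck t H0); exact: open_nbhs_nbhs.
    by apply: filterS => s hs; rewrite inner_delta induced_delta mem_set.
apply: (@ccont_near _ _ t (fun s => 0)); first exact: ccont_cst.
- by rewrite inner_delta induced_delta memNset// inner0l.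
- have : \forall s \near t, H0 ((k t)^-1 * k s)%g.
    have : nbhs (k t) [set g | H0 ((k t)^-1 * g)%g].
      have c1 : (fun g => (k t)^-1 * g)%g @ nbhs (k t) --> ((k t)^-1 * k t)%g.
        exact: lmulg_continuous.
      by apply: (c1 H0); apply: open_nbhs_nbhs; split => //; rewrite mulVg.
    by move=> h; exact: (ck t _ h).
  apply: filterS => s hs; rewrite inner_delta induced_delta memNset ?inner0l//.
  by move=> hk; apply: kt; rewrite -(H0Vi (k t)); apply/(H0Mr _ hk).
Qed.

Definition induced_rep : unitary_rep H L :=
  Build_unitary_rep induced_linear induced1 inducedM
    (fun s => isometry_inner (@induced_linear s) (@induced_nrm s)) induced_continuous.

Let c0 := coset_idx 1%g.
Let H0c0 : H0 (val c0).
Proof. by have := coset_repP 1%g; rewrite invg1 mul1g. Qed.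

Definition induced_vec (x : F) : L := delta c0 (b (val c0)^-1%g x).

Lemma induced_vec_nrm x : nrm (induced_vec x) = nrm x.
Proof. by rewrite nrm_delta b_nrm//; exact: H0V. Qed.

Lemma coef_induced x y : coef induced_rep (induced_vec x) (induced_vec y) =
  fun h => if h \in H0 then inner (b h x) y else 0.
Proof.
apply/funext => h; rewrite /coef /= inner_delta induced_delta.
have Hc := H0V H0c0.
have iff : H0 ((val c0)^-1 * h * val c0)%g <-> H0 h by rewrite H0Mr// H0Ml.
have [Hh|nHh] := pselect (H0 h).
  rewrite !mem_set//; last by apply/iff.
  rewrite -bM//; last by apply/iff.
  by rewrite mulgK bM// b_inner.
by rewrite !memNset ?inner0l// => /iff.
Qed.
End Induced.

Section PartialRep.
Context {R : realType} {H : topGroupType} {F : hilbertType R}.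

(** A *-representation beta of H0 need not be unital, but beta(1) is a
    projection commuting with it; adding the trivial representation on the
    complement makes beta unitary, and it can be induced. *)
Lemma partial_rep_coef (H0 : set H) (beta : H -> F -> F) :
  is_subgroup H0 -> open H0 -> (forall s, H0 s -> linear (beta s)) ->
  (forall s t x, H0 s -> H0 t -> beta (s * t)%g x = beta s (beta t x)) ->
  (forall s x y, H0 s -> inner (beta s x) y = inner x (beta s^-1%g y)) ->
  (forall s x y, H0 s -> ccont s (fun h => inner (beta h x) y)) ->
  exists (K : hilbertType R) (sigma : unitary_rep H K) (V : F -> K),
    (forall x, nrm (V x) <= nrm x) /\
    forall x y, coef sigma (V x) (V y) =
      fun h => if h \in H0 then inner (beta h x) y else 0.
Proof.
move=> sH oH lb bM badj bc; have [H01 H0M H0V] := sH.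
pose e := beta 1%g.
have le : linear e by exact: lb.
have be s x : H0 s -> beta s (e x) = beta s x by move=> Hs; rewrite /e -bM// mulg1.
have eb s x : H0 s -> e (beta s x) = beta s x by move=> Hs; rewrite /e -bM// mul1g.
have esym x y : inner (e x) y = inner x (e y) by rewrite /e badj// invg1.
have ee x : e (e x) = e x := be _ x H01.
(* the trivial representation is added on the kernel of e *)
pose b s x := beta s x + (x - e x).
have lb' s : H0 s -> linear (b s).
  move=> Hs a x y; rewrite /b lb// le opprD (addrACA (a *: x)).
  by rewrite scalerDr scalerBr [RHS]addrACA.
have b1 x : b 1%g x = x by rewrite /b -/(e x) addrC subrK.
have bM' s t x : H0 s -> H0 t -> b (s * t)%g x = b s (b t x).
  move=> Hs Ht; rewrite /b; set z := x - e x.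
  have sz : beta s z = 0 by rewrite (linB (lb _ Hs)) be// subrr.
  have ez : e z = 0 by rewrite (linB le) ee subrr.
  rewrite (linD (lb _ Hs)) sz addr0 (linD le) ez addr0 eb// bM//.
  by rewrite [X in _ = _ + X]addrC addKr.
have binner s x y : H0 s -> inner (b s x) (b s y) = inner x y.
  move=> Hs; rewrite /b; set zx := x - e x; set zy := y - e y.
  rewrite [LHS]innerDl (innerDr (beta s x)) (innerDr zx).
  have -> : inner (beta s x) (beta s y) = inner x (e y).
    by rewrite badj// -bM ?mulVg//; exact: H0V.
  have -> : inner (beta s x) zy = 0.
    by rewrite badj// /zy (linB (lb _ (H0V _ Hs))) be ?subrr ?inner0r//; exact: H0V.
  have -> : inner zx (beta s y) = 0.
    rewrite inner_conj badj// /zx (linB (lb _ (H0V _ Hs))) be ?subrr ?inner0r ?rmorph0//.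
    exact: H0V.
  rewrite addr0 add0r /zx /zy !(innerBl, innerBr) !esym ee subrr subr0.
  by rewrite addrC subrK.
have bcont s x y : H0 s -> ccont s (fun h => inner (b h x) y).
  move=> Hs; apply: ccont_near (ccontD (bc s x y Hs) (ccont_cst s (inner (x - e x) y))) _ _.
    by rewrite -innerDl.
  by apply: nearW => h; rewrite -innerDl.
exists (ell2 {c : H | coset_rep H0 c == c} F : hilbertType R).
exists (induced_rep sH oH lb' b1 bM' binner bcont).
exists (fun x => induced_vec b sH (e x)).
split=> [x|x y].
  rewrite induced_vec_nrm//.
  have [->|ex0] := eqVneq (nrm (e x)) 0; first exact: nrm_ge0.
  have ex : 0 < nrm (e x) by rewrite lt_neqAle eq_sym ex0 nrm_ge0.
  rewrite -(ler_pM2r ex) -expr2 nrm_sqr esym ee.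
  exact: le_trans (Re_le_nrm _) (cauchy_schwarz _ _).
rewrite coef_induced; apply/funext => h; case: ifPn => // /set_mem Hh.
by rewrite /b ee subrr addr0 be// -esym eb.
Qed.
End PartialRep.

(** * Cyclic subspaces and the norm of B(G) *)

Section ClosedSpan.
Context {R : realType} {E : hilbertType R}.

(** The closed linear span, as an intersection: to prove a property of all its
    elements it suffices that the property defines a closed subspace and
    holds for the generators. *)
Definition cspan (S : set E) : set E :=
  [set x | forall M, closed_subspace M -> S `<=` M -> M x].

Lemma cspan_closed S : closed_subspace (cspan S).
Proof.
split=> [M [M0 _ _] _ //|a x y Sx Sy M cM SM|x hx M cM SM].
  by case: (cM) => _ + _; apply; [exact: Sx|exact: Sy].
by case: (cM) => _ _; apply => e /hx[y Sy xy]; exists y => //; exact: Sy.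
Qed.

Lemma cspan_sub S : S `<=` cspan S.
Proof. by move=> x Sx M _; apply. Qed.

Lemma cspan_min S M : closed_subspace M -> S `<=` M -> cspan S `<=` M.
Proof. by move=> cM SM x; apply. Qed.

Lemma preimage_closed (T : E -> E) (M : set E) : linear T ->
  (forall x, nrm (T x) <= nrm x) -> closed_subspace M ->
  closed_subspace [set x | M (T x)].
Proof.
move=> lT bT cM; have [M0 ML Mc] := cM; split=> /=.
- by rewrite lin0.
- by move=> a x y Tx Ty; rewrite lT; exact: ML.
- move=> x hx; apply: Mc => e /hx[y My xy]; exists (T y) => //.
  by rewrite -linB//; exact: le_lt_trans xy.
Qed.

Lemma orth_closed (y : E) : closed_subspace [set x | inner x y = 0].
Proof.
split=> /= [|a x x' h h'|x hx]; first by rewrite inner0l.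
  by rewrite innerDl innerZl h h' mulr0 addr0.
apply: nrm_sep => e e0; rewrite subr0.
have [z zy xz] := hx _ (divr_gt0 e0 (ltr_wpDl (nrm_ge0 y) ltr01)).
rewrite -[inner x y]subr0 -zy -innerBl.
apply: le_lt_trans (cauchy_schwarz _ _) _; move: xz; rewrite ltr_pdivlMr ?ltr_wpDl ?nrm_ge0//.
by apply: le_lt_trans; rewrite ler_wpM2l ?nrm_ge0// lerDl.
Qed.

Context {G : topGroupType} (rho : unitary_rep G E).

Definition cyc (w : E) : set E := cspan (range (fun s => rho s w)).

Lemma rep_innerV s x y : inner (rho s x) y = inner x (rho s^-1%g y).
Proof. by rewrite -(rep_inner rho s x) -repM mulgV rep1. Qed.

Lemma cyc_closed w : closed_subspace (cyc w). Proof. exact: cspan_closed. Qed.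

Lemma cyc_gen w s : cyc w (rho s w).
Proof. by apply: cspan_sub; exists s. Qed.

Lemma cyc_self w : cyc w w.
Proof. by have := @cyc_gen w 1%g; rewrite rep1. Qed.

Lemma cyc_inv w t x : cyc w x -> cyc w (rho t x).
Proof.
apply: (@cspan_min _ [set x | cyc w (rho t x)]).
  apply: preimage_closed; [exact: rep_linear| by move=> y; rewrite rep_nrm|exact: cyc_closed].
by move=> _ [s _ <-] /=; rewrite -repM; exact: cyc_gen.
Qed.

(** The orthogonal complement of an invariant subspace is invariant too, hence
    the projection commutes with the group. *)
Lemma proj_comm (M : set E) : closed_subspace M -> (forall s x, M x -> M (rho s x)) ->
  forall s x, oproj M (rho s x) = rho s (oproj M x).
Proof.
move=> cM iM s x; apply: proj_uniq => // [|m Mm]; first exact/iM/proj_in.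
rewrite -(linB (rep_linear rho s)) rep_innerV proj_orth//; exact: iM.
Qed.
End ClosedSpan.

Section FourierStieltjes.
Context {R : realType} {G : topGroupType}.
Implicit Types (u v : G -> R[i]).

Section Coef.
Context {E : hilbertType R} (pi : unitary_rep G E).
Lemma coef_linl (a : R[i]) x x' y :
  coef pi (a *: x + x') y = a \*o coef pi x y \+ coef pi x' y.
Proof. by apply/funext => s; rewrite /coef /= rep_linear innerDl innerZl. Qed.
Lemma coef_linr (a : R[i]) x y y' :
  coef pi x (a *: y + y') = a^*%C \*o coef pi x y \+ coef pi x y'.
Proof. by apply/funext => s; rewrite /coef /= innerDr innerZr. Qed.
Lemma coef_Bl x x' y : coef pi (x - x') y = coef pi x y \- coef pi x' y.
Proof. by apply/funext => s; rewrite /coef /= (linB (rep_linear pi s)) innerBl. Qed.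
Lemma coef_Br x y y' : coef pi x (y - y') = coef pi x y \- coef pi x y'.
Proof. by apply/funext => s; rewrite /coef /= innerBr. Qed.
Lemma coef0l y : coef pi 0 y = fun=> 0.
Proof. by apply/funext => s; rewrite /coef (lin0 (rep_linear pi s)) inner0l. Qed.
Lemma coef_BG x y : BG (coef pi x y).
Proof. by exists E, pi, x, y. Qed.
Lemma coef_mull t x y : coef pi x (pi t^-1%g y) = fun s => coef pi x y (t * s)%g.
Proof. by apply/funext => s; rewrite /coef repM [RHS]rep_innerV. Qed.
Lemma coef_mulr t x y : coef pi (pi t x) y = fun s => coef pi x y (s * t)%g.
Proof. by apply/funext => s; rewrite /coef repM. Qed.
End Coef.

Lemma BG_norm_lb u : has_lbound [set r | exists (E : hilbertType R)
   (pi : unitary_rep G E) (x y : E),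
   u = coef pi x y /\ r = complex.Re (`|x| * `|y|)].
Proof.
exists 0 => _ [E [pi [x [y [_ ->]]]]].
by rewrite !nrmE -rmorphM /= mulr_ge0 ?nrm_ge0.
Qed.

Lemma BG_norm_le (E : hilbertType R) (pi : unitary_rep G E) x y :
  BG_norm (coef pi x y) <= nrm x * nrm y.
Proof.
apply: ge_inf; first exact: BG_norm_lb.
by exists E, pi, x, y; split=> //; rewrite !nrmE -rmorphM.
Qed.

(** An upper bound in terms of BG_norm may be proved for each representation of
    u as a coefficient separately. *)
Lemma BG_norm_ge u (c M : R) : BG u -> 0 <= M ->
  (forall (E : hilbertType R) (pi : unitary_rep G E) x y, u = coef pi x y ->
     c <= M * (nrm x * nrm y)) -> c <= M * BG_norm u.
Proof.
move=> [E [pi [x [y uE]]]] M0 h.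
have [M00|Mn0] := eqVneq M 0; first by have := h _ _ _ _ uE; rewrite M00 !mul0r.
have Mp : 0 < M by rewrite lt_neqAle eq_sym Mn0.
rewrite -ler_pdivrMl//; apply: lb_le_inf.
  by exists (complex.Re (`|x| * `|y|)), E, pi, x, y.
move=> _ [E' [pi' [x' [y' [u' ->]]]]].
by rewrite ler_pdivrMl// !nrmE -rmorphM /=; exact: (h E' pi').
Qed.

Lemma BG_norm_ge0 u : BG u -> 0 <= BG_norm u.
Proof.
move=> Bu; rewrite -[BG_norm u]mul1r; apply: BG_norm_ge => // E pi x y _.
by rewrite mul1r mulr_ge0 ?nrm_ge0.
Qed.

Lemma dual_bound (A : set (G -> R[i])) f : A `<=` BG -> dual_space A f ->
  exists2 M : R, 0 <= M & forall u, A u -> nrm (f u) <= M * BG_norm u.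
Proof.
move=> AB [_ [M hM]]; exists `|M| => // u Au.
apply: le_trans (hM u Au) _; rewrite ler_wpM2r ?ler_norm//.
exact/BG_norm_ge0/AB.
Qed.
End FourierStieltjes.

(** * Functionals on a closed invariant subspace of B(G) *)

Section InvariantSubspace.
Context {R : realType} {G : topGroupType} (A : set (G -> R[i])).
Hypothesis A_BG : A `<=` BG.
Hypothesis A0 : A (fun=> 0).
Hypothesis A_lin : forall (a : R[i]) u v, A u -> A v -> A (a \*o u \+ v).
Hypothesis A_closed : BG_closed A.
Hypothesis A_inv : translation_invariant A.
Implicit Types (u v : G -> R[i]).

Lemma invB u v : A u -> A v -> A (u \- v).
Proof.
move=> Au Av; have := A_lin (-1) Av Au.
by congr A; apply/funext => s /=; rewrite mulN1r addrC.
Qed.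

Lemma dual0 f : dual_space A f -> f (fun=> 0) = 0.
Proof.
move=> [lf _]; have := lf 1 _ _ A0 A0.
rewrite (_ : 1 \*o _ \+ _ = fun=> 0); last by apply/funext => s /=; rewrite mulr0 addr0.
by rewrite mul1r -[LHS]addr0 => /addrI.
Qed.

Lemma dualB f u v : dual_space A f -> A u -> A v -> f (u \- v) = f u - f v.
Proof.
move=> [lf _] Au Av; rewrite (_ : u \- v = (-1) \*o v \+ u).
  by rewrite lf// mulN1r addrC.
by apply/funext => s /=; rewrite mulN1r addrC.
Qed.

Context {F : hilbertType R} (rho : unitary_rep G F).

(** The largest closed invariant subspace all of whose coefficients lie in A. *)
Definition coef_sub : set F := [set a | forall b, A (coef rho a b)].

Lemma coef_closedl b : closed_subspace [set a | A (coef rho a b)].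
Proof.
split=> /= [|k a a' ha ha'|a ha]; first by rewrite coef0l.
  by rewrite coef_linl; exact: A_lin.
apply: A_closed => [|e e0]; first exact: coef_BG.
have [z hz az] := ha _ (divr_gt0 e0 (ltr_wpDl (nrm_ge0 b) ltr01)).
exists (coef rho z b) => //; rewrite -coef_Bl.
apply: le_lt_trans (BG_norm_le _ _ _) _; move: az; rewrite ltr_pdivlMr ?ltr_wpDl ?nrm_ge0//.
by apply: le_lt_trans; rewrite ler_wpM2l ?nrm_ge0// lerDl.
Qed.

Lemma coef_closedr a : closed_subspace [set b | A (coef rho a b)].
Proof.
split=> /= [|k b b' hb hb'|b hb].
- suff -> : coef rho a 0 = fun=> 0 by [].
  by apply/funext => s; rewrite /coef inner0r.
- by rewrite coef_linr; exact: A_lin.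
apply: A_closed => [|e e0]; first exact: coef_BG.
have [z hz bz] := hb _ (divr_gt0 e0 (ltr_wpDl (nrm_ge0 a) ltr01)).
exists (coef rho a z) => //; rewrite -coef_Br.
apply: le_lt_trans (BG_norm_le _ _ _) _; move: bz; rewrite ltr_pdivlMr ?ltr_wpDl ?nrm_ge0//.
by rewrite mulrC; apply: le_lt_trans; rewrite ler_wpM2r ?nrm_ge0// lerDl.
Qed.

Lemma coef_sub_closed : closed_subspace coef_sub.
Proof.
split=> [b|k a a' ha ha' b|a ha b].
- by case: (coef_closedl b).
- by case: (coef_closedl b) => _ h _; exact: h.
- by case: (coef_closedl b) => _ _ h; apply: h => e /ha[z hz az]; exists z.
Qed.

Lemma coef_sub_inv s a : coef_sub a -> coef_sub (rho s a).
Proof. by move=> ha b; rewrite coef_mulr; case: (A_inv (ha b) s). Qed.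

Local Notation Q := (oproj coef_sub).

Lemma coef_projr a b : coef_sub a -> coef rho a (Q b) = coef rho a b.
Proof.
move=> ha; apply/funext => s; rewrite /coef inner_projr//; first exact: coef_sub_closed.
exact: coef_sub_inv.
Qed.

Lemma coef_projl a b : coef_sub b -> coef rho (Q a) b = coef rho a b.
Proof.
move=> hb; apply/funext => s.
rewrite /coef !rep_innerV inner_projl//; first exact: coef_sub_closed.
exact: coef_sub_inv.
Qed.

(** Compress x to the cyclic subspace of y, so that all coefficients of the new
    vector x1 are limits of translates of u; then compress y to coef_sub. *)
Lemma coef_reduce x y : A (coef rho x y) ->
  exists x1 y1, [/\ coef_sub x1, coef_sub y1, nrm x1 <= nrm x, nrm y1 <= nrm y
    & coef rho x y = coef rho x1 y1].
Proof.
move=> Axy; have cC := cyc_closed rho y; pose x1 := oproj (cyc rho y) x.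
have x1E t : coef rho x1 (rho t y) = coef rho x (rho t y).
  apply/funext => s; rewrite /coef !rep_innerV -repM inner_projl//.
  exact: cyc_gen.
have xx1 : coef rho x y = coef rho x1 y by have := x1E 1%g; rewrite rep1.
have x1A : coef_sub x1.
  move=> b.
  have -> : coef rho x1 b = coef rho x1 (oproj (cyc rho y) b).
    apply/funext => s; rewrite /coef (inner_projr cC)//.
    by apply: cyc_inv; exact: (proj_in cC).
  have : cyc rho y `<=` [set b | A (coef rho x1 b)].
    apply: cspan_min; first exact: coef_closedr.
    move=> _ [t _ <-] /=; rewrite x1E -[t]invgK coef_mull.
    by case: (A_inv Axy t^-1%g).
  by apply; exact: (proj_in cC).
exists x1, (Q y); split=> //.
- exact: (proj_in coef_sub_closed).
- exact: (proj_nrm cC).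
- exact: (proj_nrm coef_sub_closed).
- by rewrite coef_projr.
Qed.

(** For f in the dual of A this is the action of f on the coefficient subspace
    of an arbitrary representation; it generalizes the identification of the
    dual of A_pi with operators on the space of pi. *)
Lemma functional_op (f : (G -> R[i]) -> R[i]) (M : R) : dual_space A f -> 0 <= M ->
  (forall u, A u -> nrm (f u) <= M * BG_norm u) ->
  exists B : F -> F, [/\ bounded_op B,
    forall a b, inner (B a) b = f (coef rho (Q a) b),
    forall a, coef_sub (B a) & forall a, nrm (B a) <= M * nrm a].
Proof.
move=> df M0 bf; have cS := coef_sub_closed; have [lf _] := df.
have AQ a b : A (coef rho (Q a) b) by have := proj_in cS a; apply.
have [a x x' y|a x y y'|x y|B [bB BE nB]] :=
    @form_op _ _ (fun a b => f (coef rho (Q a) b)) M _ _ M0.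
- by rewrite (proj_linear cS) coef_linl lf//.
- by rewrite coef_linr lf//.
- rewrite (le_trans (bf _ (AQ _ _)))// -mulrA ler_wpM2l//.
  rewrite (le_trans (BG_norm_le _ _ _))// ler_wpM2r ?nrm_ge0//.
  exact: (proj_nrm cS).
exists B; split=> //.
move=> a; suff -> : B a = Q (B a) by exact: (proj_in cS).
apply/eqP; rewrite -subr_eq0; apply/eqP/inner_eq0.
set z := B a - _; rewrite {1}/z innerBl.
  have Qz : Q z = 0 by rewrite /z (linB (proj_linear cS)) (proj_id cS (proj_in cS _)) subrr.
  rewrite (proj_sym cS) Qz inner0r subr0 BE -coef_projr; last exact: (proj_in cS).
  rewrite Qz; have -> : coef rho (Q a) 0 = fun=> 0.
    by apply/funext => s; rewrite /coef inner0r.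
exact: dual0.
Qed.

End InvariantSubspace.

Section Density.
Context {R : realType} {G : topGroupType} {E : hilbertType R} (pi : unitary_rep G E).
Hypothesis A_alg : is_subalgebra (Api pi).

Lemma Api_BG : Api pi `<=` BG. Proof. by case: A_alg. Qed.

Lemma coef_Api x y : Api pi (coef pi x y).
Proof.
split; first exact: coef_BG.
move=> e e0; exists (coef pi x y).
  exists 1%N, (fun=> 1), (fun=> x), (fun=> y).
  by apply/funext => s; rewrite big_ord1 mul1r.
rewrite -coef_Bl subrr; apply: le_lt_trans (BG_norm_le _ _ _) _.
by rewrite nrm0 mul0r.
Qed.

Lemma coef_span_Api u : coef_span pi u -> Api pi u.
Proof.
have [_ A0 lA _] := A_alg.
move=> [n [c [x [y ->]]]]; elim: n c x y => [|n IH] c x y.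
  by rewrite (_ : (fun s => _) = fun=> 0)//; apply/funext => s; rewrite big_ord0.
have := lA (c ord0) _ _ (coef_Api (x ord0) (y ord0))
  (IH (c \o lift ord0) (x \o lift ord0) (y \o lift ord0)).
by congr (Api pi); apply/funext => s; rewrite big_ord_recl.
Qed.

Lemma dual_span f n (c : 'I_n -> R[i]) (x y : 'I_n -> E) : dual_space (Api pi) f ->
  f (fun s => \sum_i c i * coef pi (x i) (y i) s) = \sum_i c i * f (coef pi (x i) (y i)).
Proof.
have [_ A0 lA _] := A_alg => df; have [lf _] := df.
elim: n c x y => [|n IH] c x y.
  rewrite big_ord0 (_ : (fun s => _) = fun=> 0); first exact: (dual0 A0 df).
  by apply/funext => s; rewrite big_ord0.
rewrite big_ord_recl -IH -lf; [|exact: coef_Api|apply: coef_span_Api].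
  by congr f; apply/funext => s; rewrite big_ord_recl.
by exists n, (c \o lift ord0), (x \o lift ord0), (y \o lift ord0).
Qed.

(** Coefficients of pi span a dense subspace of A_pi. *)
Lemma dual_ext f g : dual_space (Api pi) f -> dual_space (Api pi) g ->
  (forall x y, f (coef pi x y) = g (coef pi x y)) ->
  forall u, Api pi u -> f u = g u.
Proof.
move=> df dg fg u Au; have [_ A0 lA _] := A_alg.
have [M M0 bf] := dual_bound Api_BG df; have [N N0 bg] := dual_bound Api_BG dg.
apply: nrm_sep => e e0.
have MN : 0 < M + N + 1 by rewrite ltr_wpDl ?addr_ge0.
have [_ /(_ _ (divr_gt0 e0 MN))[v Sv uv]] := Au.
have Av := coef_span_Api Sv.
have fgv : f v = g v.
  by case: Sv => n [c [x [y ->]]]; rewrite !dual_span//; apply: eq_bigr => i _; rewrite fg.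
have Auv : Api pi (u \- v) by exact: (invB lA Au Av).
have -> : f u - g u = f (u \- v) - g (u \- v).
  by rewrite !(dualB _ Au Av)// fgv opprB addrA subrK.
move: uv; rewrite ltr_pdivlMr// mulrC; apply: le_lt_trans.
rewrite (le_trans (nrmD _ _))// nrmN (le_trans (lerD (bf _ Auv) (bg _ Auv)))//.
by rewrite -mulrDl ler_wpM2r ?lerDl//; exact/BG_norm_ge0/Api_BG.
Qed.

Lemma pairingP T f : dual_space (Api pi) f -> (forall x y, f (coef pi x y) = inner (T x) y) ->
  dual_space (Api pi) (pairing pi T) /\ forall x y, pairing pi T (coef pi x y) = inner (T x) y.
Proof.
move=> df fT; rewrite /pairing; case: xgetP => [g _ []//|/(_ f)]; by case.
Qed.

(** A character is nonzero, so its pairing is not the default value: the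
    functional on A_pi that extends <pi(.)x|y> |-> <Tx|y> exists. *)
Lemma spectrum_pairing T : spectrum pi T -> dual_space (Api pi) (pairing pi T) /\
  forall x y, pairing pi T (coef pi x y) = inner (T x) y.
Proof.
move=> [_ [u Au] + _]; rewrite {1}/pairing; case: xgetP => [g _ [dg gT] _|_ /eqP//].
exact: pairingP dg gT.
Qed.
End Density.

(** * The homomorphism j_alpha *)

Section Contractions.
Context {R : realType} {G : topGroupType} {E : hilbertType R} (pi : unitary_rep G E).

Lemma VN_bounded T : VN pi T -> bounded_op T.
Proof. by case. Qed.

Lemma spectrum_linear T : spectrum pi T -> linear T.
Proof. by case=> /VN_bounded[]. Qed.

Lemma op_norm_bound (T : E -> E) x : bounded_op T -> nrm (T x) <= op_norm T * nrm x.
Proof.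
move=> /bounded_opP[lT [M M0 bT]].
have [x0|x0] := eqVneq (nrm x) 0; first by rewrite (nrm_eq0 x0) lin0// !nrm0 mulr0.
have nx : 0 < nrm x by rewrite lt_neqAle eq_sym x0 nrm_ge0.
have iv : 0 < (nrm x)^-1 by rewrite invr_gt0.
have nk : nrm ((nrm x)^-1)%:C = (nrm x)^-1 by rewrite nrm_real gtr0_norm.
rewrite -ler_pdivrMr// mulrC -nk -nrmZ -linZ//; apply: ub_le_sup.
  exists M => _ [y y1 <-]; apply: le_trans (bT y) _.
  by rewrite -[leRHS]mulr1 ler_wpM2l//; move: y1; rewrite /= nrmE (lecR _ 1).
exists ((nrm x)^-1%:C *: x) => //=.
by rewrite nrmE (lecR _ 1) nrmZ nk mulVf.
Qed.

(** For x in the range of e and z in its kernel, |x| = |e(x - az)| <= |x - az|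
    for all scalars a, so x is orthogonal to z: e is the orthogonal
    projection onto its range. *)
Lemma idempotent_sym (e : E -> E) : linear e -> (forall x, e (e x) = e x) ->
  (forall x, nrm (e x) <= nrm x) -> forall x y, inner (e x) y = inner x (e y).
Proof.
move=> le ee ne.
have orth x y : inner (e x) (y - e y) = 0.
  apply: inner0_of_min => a; have := ne (e x - a *: (y - e y)).
  by rewrite (linB le) (linZ le) (linB le) !ee subrr scaler0 subr0.
have ex x y : inner (e x) y = inner (e x) (e y).
  by apply/eqP; rewrite -subr_eq0 -innerBr orth eqxx.
by move=> x y; rewrite ex [RHS]inner_conj (ex y x) -inner_conj.
Qed.
End Contractions.

Section Jmap.
Context {R : realType} {G H : topGroupType} {E : hilbertType R} (pi : unitary_rep G E).
Local Notation A := (Api pi).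
Hypothesis A_alg : is_subalgebra A.
Hypothesis A_closed : BG_closed A.
Hypothesis A_inv : translation_invariant A.
Hypothesis norm1 : forall T, spectrum pi T -> op_norm T = 1.
Variables (H0 : set H) (alpha : H -> E -> E).
Hypothesis H0_sub : is_subgroup H0.
Hypothesis H0_open : open H0.
Hypothesis alpha_spec : forall s, H0 s -> spectrum pi (alpha s).
Hypothesis alpha_hom : forall s t, H0 s -> H0 t ->
     alpha (s * t)%g = alpha s \o alpha t.
Hypothesis alpha_cont : {within H0, continuous (fun h => weak_star pi (alpha h))}.

Let A_BG : A `<=` BG. Proof. by case: A_alg. Qed.
Let A_0 : A (fun=> 0). Proof. by case: A_alg. Qed.
Let A_lin : forall (a : R[i]) u v, A u -> A v -> A (a \*o u \+ v).
Proof. by case: A_alg. Qed.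
Let H01 : H0 1%g. Proof. by case: H0_sub. Qed.
Let H0V s : H0 s -> H0 (s^-1)%g. Proof. by case: H0_sub => _ _; apply. Qed.
Let H0M s t : H0 s -> H0 t -> H0 (s * t)%g. Proof. by case: H0_sub => _ + _; apply. Qed.

Lemma alpha_linear s : H0 s -> linear (alpha s).
Proof. by move=> /alpha_spec/spectrum_linear. Qed.

Lemma alphaM s t x : H0 s -> H0 t -> alpha (s * t)%g x = alpha s (alpha t x).
Proof. by move=> Hs Ht; rewrite alpha_hom. Qed.

Lemma alpha_nrm s x : H0 s -> nrm (alpha s x) <= nrm x.
Proof.
move=> Hs; have sp := alpha_spec Hs; have := @op_norm_bound _ _ (alpha s) x.
by rewrite norm1// mul1r; apply; case: sp => /VN_bounded.
Qed.

(** On the range of the projection alpha(1) the contractions alpha(s) and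
    alpha(s^-1) are inverse to each other, so alpha(s) is isometric there. *)
Lemma alpha_adj s x y : H0 s -> inner (alpha s x) y = inner x (alpha s^-1%g y).
Proof.
move=> Hs; pose e := alpha 1%g.
have le : linear e by exact: alpha_linear.
have ls := alpha_linear Hs.
have eE t z : H0 t -> alpha t (e z) = alpha t z /\ e (alpha t z) = alpha t z.
  by move=> Ht; rewrite /e -!alphaM// mulg1 mul1g.
have esym : forall x y, inner (e x) y = inner x (e y).
  apply: idempotent_sym => // z; first exact: (proj1 (eE _ z H01)).
  exact: alpha_nrm.
have iso z : nrm (alpha s z) = nrm (e z).
  apply/eqP; rewrite eq_le; apply/andP; split.
    by rewrite -(proj1 (eE _ z Hs)) alpha_nrm.
  by rewrite /e -(mulVg s) alphaM ?alpha_nrm//; exact: H0V.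
rewrite -(proj2 (eE _ x Hs)) esym /e -(mulgV s) alphaM//; last exact: H0V.
rewrite (polarize ls le iso) esym.
by rewrite !(proj2 (eE _ y (H0V Hs))).
Qed.

Let pairing_dual T : spectrum pi T -> dual_space A (pairing pi T).
Proof. by move=> /spectrum_pairing[]. Qed.

Let pairing_coef T x y : spectrum pi T -> pairing pi T (coef pi x y) = inner (T x) y.
Proof. by move=> /spectrum_pairing[_ ->]. Qed.

Lemma alpha_pairing_cont s u : H0 s -> A u -> ccont s (fun h => pairing pi (alpha h) u).
Proof.
move=> Hs Au; apply/ccontP.
have := alpha_cont; rewrite continuous_open_subspace// => /(_ s (mem_set Hs)) c.
pose a : Api pi := exist _ u (mem_set Au).
have := @cvg_comp _ _ _ (fun h => weak_star pi (alpha h)) (fun f => f a) _ _ _ c.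
apply; exact: (@proj_continuous A (fun=> R[i]^o) a (weak_star pi (alpha s))).
Qed.

(** The module action of functionals on A: it satisfies <TS, u> = <T, S.u>, and
    in a representation it moves the first vector of a coefficient. *)
Definition act (f : (G -> R[i]) -> R[i]) (u : G -> R[i]) : G -> R[i] :=
  fun s => f (fun t => u (s * t)%g).

Lemma act_coef (F : hilbertType R) (rho : unitary_rep G F) f (B : F -> F) a b :
  (forall a b, inner (B a) b = f (coef rho (oproj (coef_sub A rho) a) b)) ->
  coef_sub A rho a -> act f (coef rho a b) = coef rho (B a) b.
Proof.
move=> BE ha; apply/funext => s; rewrite /act [RHS]rep_innerV BE.
rewrite proj_id//; last exact: coef_sub_closed.
by rewrite coef_mull.
Qed.

(** In every representation carrying u, the action of f on u is the action of a
    bounded operator on a vector of coef_sub. *)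
Lemma act_bound f : dual_space A f -> exists2 M : R, 0 <= M &
  forall u, A u -> A (act f u) /\ BG_norm (act f u) <= M * BG_norm u.
Proof.
move=> df; have [M M0 bf] := dual_bound A_BG df; exists M => // u Au.
have Bu := A_BG Au.
have key (F : hilbertType R) (rho : unitary_rep G F) x y : u = coef rho x y ->
    A (act f u) /\ BG_norm (act f u) <= M * (nrm x * nrm y).
  move=> uE; rewrite uE in Au *.
  have [x1 [y1 [hx1 hy1 nx1 ny1 ->]]] := coef_reduce A_0 A_lin A_closed A_inv Au.
  have [B [_ BE BS Bn]] := functional_op A_0 A_lin A_closed A_inv rho df M0 bf.
  rewrite (act_coef _ BE)//; split; first exact: BS.
  apply: le_trans (BG_norm_le _ _ _) _; rewrite mulrA ler_pM ?nrm_ge0//.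
  by apply: le_trans (Bn _) _; rewrite ler_wpM2l.
split; first by case: Bu => F [rho [x [y uE]]]; case: (key _ _ _ _ uE).
by apply: BG_norm_ge => // F rho x y uE; case: (key _ _ _ _ uE).
Qed.

Lemma act_linear f a u v : dual_space A f -> A u -> A v ->
  act f (a \*o u \+ v) = a \*o act f u \+ act f v.
Proof.
move=> [lf _] Au Av; apply/funext => s; rewrite /act /= -lf//.
  by case: (A_inv Au s).
by case: (A_inv Av s).
Qed.

Lemma act_dual f g : dual_space A f -> dual_space A g ->
  dual_space A (fun u => g (act f u)).
Proof.
move=> df dg; have [M M0 bf] := act_bound df; have [N N0 bg] := dual_bound A_BG dg.
split=> [a u v Au Av|].
  by rewrite act_linear//; case: dg => + _; apply; [case: (bf _ Au)|case: (bf _ Av)].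
exists (N * M) => u Au; have [A1 n1] := bf u Au.
by apply: le_trans (bg _ A1) _; rewrite -mulrA ler_wpM2l.
Qed.

(** Products of operators in VN_pi are expressed through the functionals alone,
    so that they can be transported to other representations. *)
Lemma pairing_comp S T : spectrum pi S -> spectrum pi T -> spectrum pi (T \o S) ->
  forall u, A u -> pairing pi (T \o S) u = pairing pi T (act (pairing pi S) u).
Proof.
move=> sS sT sTS; apply: (dual_ext A_alg); first exact: pairing_dual.
  by apply: act_dual; exact: pairing_dual.
move=> x y; rewrite pairing_coef//.
have -> : act (pairing pi S) (coef pi x y) = coef pi (S x) y.
  by apply/funext => s; rewrite /act -coef_mull pairing_coef// [RHS]rep_innerV.
by rewrite pairing_coef.
Qed.

(** The involution of B(G), which exchanges the two vectors of a coefficient. *)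
Definition flip (u : G -> R[i]) : G -> R[i] := fun s => (u s^-1%g)^*%C.

Lemma flip_coef (F : hilbertType R) (rho : unitary_rep G F) a b :
  flip (coef rho a b) = coef rho b a.
Proof.
by apply/funext => s; rewrite /flip /coef rep_innerV invgK -inner_conj.
Qed.

Lemma flip_bound u : A u -> A (flip u) /\ BG_norm (flip u) <= BG_norm u.
Proof.
move=> Au; have Bu := A_BG Au; split; last first.
  rewrite -[leRHS]mul1r; apply: BG_norm_ge => // F rho x y ->.
  by rewrite flip_coef mul1r mulrC; exact: BG_norm_le.
case: Bu => F [rho [x [y uE]]]; rewrite uE in Au *.
have [x1 [y1 [hx1 hy1 nx1 ny1 ->]]] := coef_reduce A_0 A_lin A_closed A_inv Au.
by rewrite flip_coef; exact: hy1.
Qed.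

Lemma flip_dual f : dual_space A f -> dual_space A (fun u => (f (flip u))^*%C).
Proof.
move=> df; have [M M0 bf] := dual_bound A_BG df; split=> [a u v Au Av|].
  have -> : flip (a \*o u \+ v) = a^*%C \*o flip u \+ flip v.
    by apply/funext => s; rewrite /flip /= rmorphD rmorphM.
  have [[[lf _] [Fu _]] [Fv _]] := (df, flip_bound Au, flip_bound Av).
  by rewrite (lf _ _ _ Fu Fv) rmorphD rmorphM /= conjcK.
exists M => u Au; have [A1 n1] := flip_bound Au.
apply: (@le_trans _ _ (nrm (f (flip u)))); first by rewrite -/(nrm _) nrm_conj.
by apply: le_trans (bf _ A1) _; rewrite ler_wpM2l.
Qed.

Lemma pairing_adj s u : H0 s -> A u ->
  pairing pi (alpha s^-1%g) u = (pairing pi (alpha s) (flip u))^*%C.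
Proof.
move=> Hs; have sp := alpha_spec Hs; have sp' := alpha_spec (H0V Hs).
move: u; apply: (dual_ext A_alg); first exact: pairing_dual.
  by apply: flip_dual; exact: pairing_dual.
move=> x y; rewrite flip_coef !pairing_coef// -inner_conj.
by rewrite inner_conj -alpha_adj// -inner_conj.
Qed.

(** The functionals alpha(h) act on the coefficient subspace of rho by a
    *-representation of H0, which is then induced to H. *)
Lemma j_coef (F : hilbertType R) (rho : unitary_rep G F) x y : A (coef rho x y) ->
  exists (K : hilbertType R) (sigma : unitary_rep H K) (a b : K),
    [/\ j_map pi H0 alpha (coef rho x y) = coef sigma a b,
        nrm a <= nrm x & nrm b <= nrm y].
Proof.
move=> Axy.
have cS := coef_sub_closed A_0 A_lin A_closed rho.
have [x1 [y1 [hx1 hy1 nx1 ny1 ->]]] := coef_reduce A_0 A_lin A_closed A_inv Axy.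
have [beta hb] : exists beta : H -> F -> F, forall h, H0 h ->
    [/\ bounded_op (beta h),
    forall a b, inner (beta h a) b = pairing pi (alpha h) (coef rho (oproj (coef_sub A rho) a) b)
    & forall a, coef_sub A rho (beta h a)].
  have : forall h, exists B : F -> F, H0 h -> [/\ bounded_op B,
      forall a b, inner (B a) b = pairing pi (alpha h) (coef rho (oproj (coef_sub A rho) a) b)
      & forall a, coef_sub A rho (B a)].
    move=> h; have [Hh|nHh] := pselect (H0 h); last by exists id.
    have dh := pairing_dual (alpha_spec Hh).
    have [M M0 bf] := dual_bound A_BG dh.
    by have [B [b1 b2 b3 _]] := functional_op A_0 A_lin A_closed A_inv rho dh M0 bf; exists B.
  by move=> /choice[beta hbeta]; exists beta.
have Acoef a b : A (coef rho (oproj (coef_sub A rho) a) b).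
  by have := proj_in cS a; apply.
have QQ a : oproj (coef_sub A rho) (oproj (coef_sub A rho) a) = oproj (coef_sub A rho) a.
  by rewrite (proj_id cS)//; exact: (proj_in cS).
have bQ h a : H0 h -> beta h (oproj (coef_sub A rho) a) = beta h a.
  by move=> /hb[_ bE _]; apply: inner_ext => b; rewrite !bE QQ.
have lb s : H0 s -> linear (beta s) by move=> /hb[[]].
have bM s t a : H0 s -> H0 t -> beta (s * t)%g a = beta s (beta t a).
  move=> Hs Ht; have [_ bs _] := hb _ Hs; have [_ bt St] := hb _ Ht.
  have [_ bst _] := hb _ (H0M Hs Ht).
  apply: inner_ext => b; rewrite bst bs alpha_hom// pairing_comp//.
  - rewrite (act_coef _ bt); last exact: (proj_in cS).
    by rewrite bQ// (proj_id cS (St _)).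
  - exact: alpha_spec.
  - exact: alpha_spec.
  - by rewrite -alpha_hom//; apply/alpha_spec/H0M.
have badj s a b : H0 s -> inner (beta s a) b = inner a (beta s^-1%g b).
  move=> Hs; have [_ bs _] := hb _ Hs; have [_ bs' _] := hb _ (H0V Hs).
  rewrite [RHS]inner_conj bs bs' pairing_adj// flip_coef conjcK; congr (pairing _ _ _).
  rewrite -(coef_projr A_0 A_lin A_closed A_inv b (proj_in cS a)).
  by rewrite (coef_projl A_0 A_lin A_closed A_inv _ (proj_in cS b)).
have bc s a b : H0 s -> ccont s (fun h => inner (beta h a) b).
  move=> Hs; apply: ccont_near (alpha_pairing_cont Hs (Acoef a b)) _ _.
    by have [_ -> _] := hb _ Hs.
  have : \forall h \near s, H0 h by exact: open_nbhs_nbhs.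
  by apply: filterS => h /hb[_ -> _].
have [K [sigma [V [nV coefV]]]] := partial_rep_coef H0_sub H0_open lb bM badj bc.
exists K, sigma, (V x1), (V y1); split; last 2 first.
- exact: le_trans (nV _) nx1.
- exact: le_trans (nV _) ny1.
rewrite coefV; apply/funext => h; rewrite /j_map; case: ifPn => // /set_mem Hh.
by have [_ -> _] := hb _ Hh; rewrite (proj_id cS hx1).
Qed.

Lemma j_bounded u : A u -> BG (j_map pi H0 alpha u) /\
  BG_norm (j_map pi H0 alpha u) <= BG_norm u.
Proof.
move=> Au; have Bu := A_BG Au; split.
  case: Bu => F [rho [x [y uE]]]; rewrite uE in Au *.
  by have [K [sigma [a [b [-> _ _]]]]] := j_coef Au; exact: coef_BG.
rewrite -[leRHS]mul1r; apply: BG_norm_ge => // F rho x y uE; rewrite uE in Au *.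
have [K [sigma [a [b [-> na nb]]]]] := j_coef Au; rewrite mul1r.
by apply: le_trans (BG_norm_le _ _ _) _; rewrite ler_pM ?nrm_ge0.
Qed.

Lemma j_linear a u v : A u -> A v ->
  j_map pi H0 alpha (a \*o u \+ v) = a \*o j_map pi H0 alpha u \+ j_map pi H0 alpha v.
Proof.
move=> Au Av; apply/funext => h; rewrite /j_map /=.
case: ifPn => [/set_mem Hh|_]; last by rewrite mulr0 addr0.
by have [lf _] := pairing_dual (alpha_spec Hh); rewrite lf.
Qed.

Lemma j_homomorphism : algebra_homomorphism A (j_map pi H0 alpha).
Proof.
split=> [u /j_bounded[]//|a u v|u v Au Av]; first exact: j_linear.
apply/funext => h; rewrite /j_map /=.
case: ifPn => [/set_mem Hh|_]; last by rewrite mulr0.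
by have [_ _ ->] := alpha_spec Hh.
Qed.

(** On the coefficients of pi itself, j_alpha is implemented by one
    representation of H and one map V; complete positivity rests on this. *)
Lemma j_coef_pi : exists (K : hilbertType R) (sigma : unitary_rep H K) (V : E -> K),
  forall x y, j_map pi H0 alpha (coef pi x y) = coef sigma (V x) (V y).
Proof.
have bc s x y : H0 s -> ccont s (fun h => inner (alpha h x) y).
  move=> Hs; apply: ccont_near (alpha_pairing_cont Hs (coef_Api pi x y)) _ _.
    by rewrite pairing_coef//; exact: alpha_spec.
  have : \forall h \near s, H0 h by exact: open_nbhs_nbhs.
  by apply: filterS => h Hh; rewrite pairing_coef//; exact: alpha_spec.
have [K [sigma [V [nV coefV]]]] :=
  partial_rep_coef H0_sub H0_open alpha_linear alphaM alpha_adj bc.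
exists K, sigma, V => x y; rewrite coefV; apply/funext => h; rewrite /j_map.
by case: ifPn => // /set_mem Hh; rewrite pairing_coef//; exact: alpha_spec.
Qed.
End Jmap.

(** * The universal representation and the bicommutant *)

Section IsometricExtension.
Context {R : realType} {L K : hilbertType R} {T : Type} (p : T -> L) (q : T -> K).
Hypothesis pq : forall s t, inner (p s) (p t) = inner (q s) (q t).

Definition closed_rel (M : L -> K -> Prop) : Prop :=
  [/\ M 0 0,
      forall (k : R[i]) a a' b b', M a a' -> M b b' -> M (k *: a + b) (k *: a' + b')
    & forall a a', (forall e : R, 0 < e ->
        exists b b', [/\ M b b', nrm (a - b) < e & nrm (a' - b') < e]) -> M a a'].

(** The closed linear span, in the product of the two spaces, of the pairs (p t,
    q t). When the Gram matrices of p and q agree it is the graph of an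
    isometry. *)
Definition graph (a : L) (a' : K) : Prop :=
  forall M, closed_rel M -> (forall t, M (p t) (q t)) -> M a a'.

Lemma graph_closed : closed_rel graph.
Proof.
split=> [M [M0 _ _] _ //|k a a' b b' ha hb M cM Mt|a a' ha M cM Mt].
  by case: (cM) => _ + _; apply; [exact: ha|exact: hb].
case: (cM) => _ _; apply => e /ha[b [b' [hb ab ab']]].
by exists b, b'; split => //; exact: hb.
Qed.

Lemma closed_rel_inner (c : L) (c' : K) :
  closed_rel (fun a a' => inner a c = inner a' c').
Proof.
split=> [|k a a' b b' ha hb|a a' h]; first by rewrite !inner0l.
  by rewrite !innerDl !innerZl ha hb.
apply: nrm_sep => e e0.
have C0 : 0 < nrm c + nrm c' + 1 by rewrite ltr_wpDl ?addr_ge0 ?nrm_ge0.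
have [b [b' [hb ab ab']]] := h _ (divr_gt0 e0 C0).
have -> : inner a c - inner a' c' = inner (a - b) c - inner (a' - b') c'.
  by rewrite !innerBl hb opprB addrA subrK.
set d := e / _ in ab ab'; have d0 : 0 < d by rewrite divr_gt0.
have de : d * (nrm c + nrm c' + 1) = e by rewrite /d divfK// gt_eqF.
apply: le_lt_trans (nrmD _ _) _; rewrite nrmN -de.
apply: (@le_lt_trans _ _ (d * nrm c + d * nrm c')).
  apply: lerD; apply: le_trans (cauchy_schwarz _ _) _;
    by rewrite ler_wpM2r ?nrm_ge0 ?ltW.
by rewrite -mulrDr ltr_pM2l// ltrDl.
Qed.

Lemma graph_inner a a' b b' : graph a a' -> graph b b' -> inner a b = inner a' b'.
Proof.
have gen t c c' : graph c c' -> inner c (p t) = inner c' (q t).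
  move=> /(_ (fun a a' => inner a (p t) = inner a' (q t))); apply => [|s].
    exact: closed_rel_inner.
  exact: pq.
move=> ga gb; apply: ga (closed_rel_inner b b') _ => t.
by rewrite inner_conj (gen t _ _ gb) -inner_conj.
Qed.

Lemma graph_nrm a a' : graph a a' -> nrm a' = nrm a.
Proof.
by move=> g; apply/eqP; rewrite -(@eqrXn2 _ 2) ?nrm_ge0// !nrm_sqr (graph_inner g g).
Qed.

(** The set where the isometry is defined is closed: along a convergent sequence
    of first components the second components form a Cauchy sequence. *)
Lemma graph_dom a : cspan (range p) a -> exists a', graph a a'.
Proof.
have [g0 gl gc] := graph_closed.
have gB x x' y y' : graph x x' -> graph y y' -> graph (x - y) (x' - y').
  by move=> gx gy; have := gl (-1) _ _ _ _ gy gx; rewrite !scaleN1r addrC [- y' + _]addrC.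
move=> /(_ [set a | exists a', graph a a']); apply; last first.
  by move=> _ [t _ <-]; exists (q t) => M _; apply.
split=> [|k x y [x' gx] [y' gy]|x hx]; first by exists 0.
  by exists (k *: x' + y'); exact: gl.
have /choice[y hy] : forall n : nat, exists y : L * K,
    graph y.1 y.2 /\ nrm (x - y.1) < n.+1%:R^-1.
  move=> n; have [|y [y' gy] xy] := hx n.+1%:R^-1; first by rewrite invr_gt0.
  by exists (y, y').
have [e e0|l hl] := @seq_complete R K (fun n => (y n).2).
  have e2 : 0 < e / 2 by rewrite divr_gt0.
  have [N hN] := inv_lt e2; exists N => n m Nn Nm.
  have [gn xn] := hy n; have [gm xm] := hy m.
  rewrite (graph_nrm (gB _ _ _ _ gn gm)) (le_lt_trans (nrm_dist _ x _))//.
  rewrite [ltRHS]splitr nrmB ltrD//; first exact: lt_trans xn (hN _ Nn).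
  exact: lt_trans xm (hN _ Nm).
exists l; apply: gc => e e0; have [N hN] := hl _ e0; have [N' hN'] := inv_lt e0.
pose n := maxn N N'; exists (y n).1, (y n).2; split.
- by case: (hy n).
- by case: (hy n) => _ /lt_trans; apply; apply: hN'; rewrite leq_maxr.
- by apply: hN; rewrite leq_maxl.
Qed.

Lemma graph_map (U : L -> L) (W : K -> K) : linear U -> linear W ->
  (forall a, nrm (U a) <= nrm a) -> (forall a, nrm (W a) <= nrm a) ->
  (forall t, exists2 s, U (p t) = p s & W (q t) = q s) ->
  forall a a', graph a a' -> graph (U a) (W a').
Proof.
move=> lU lW bU bW UW a a'; have [g0 gl gc] := graph_closed.
move=> /(_ (fun a a' => graph (U a) (W a'))); apply; last by move=> t; have [s -> ->] := UW t; move=> M _; apply.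
split=> [|k x x' y y' gx gy|x x' hx]; first by rewrite !lin0.
  by rewrite lU lW; exact: gl.
apply: gc => e /hx[y [y' [gy xy xy']]]; exists (U y), (W y'); split=> //.
- by rewrite -(linB lU); exact: le_lt_trans xy.
- by rewrite -(linB lW); exact: le_lt_trans xy'.
Qed.
End IsometricExtension.

Section Universal.
Context {R : realType} {G : topGroupType} {K : hilbertType R} (om : unitary_rep G K).
Hypothesis om_univ : is_universal om.

Lemma coef_state (L : hilbertType R) (sigma : unitary_rep G L) (w : L) :
  nrm w = 1 -> states (coef sigma w w).
Proof.
move=> w1; split.
- by move=> s; apply/ccontP; exact: rep_weak_cont.
- move=> n c s.
  have -> : \sum_i \sum_j c i * (c j)^*%C * coef sigma w w ((s j)^-1 * s i)%g =
    inner (\sum_i c i *: sigma (s i) w) (\sum_i c i *: sigma (s i) w).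
    rewrite inner_suml; apply: eq_bigr => i _; rewrite inner_sumr.
    apply: eq_bigr => j _; rewrite innerZl innerZr mulrA /coef repM rep_innerV invgK.
    by [].
  by rewrite inner_nrm (lecR 0) sqr_ge0.
- by rewrite /coef rep1 inner_nrm w1 expr1n.
Qed.

(** For a unit vector w, the state of w is the state of one of the vectors xi of
    the universal representation, so s |-> sigma(s)w and s |-> om(s)xi have
    the same Gram matrix, and the isometry between their closed spans
    intertwines sigma and om. *)
Lemma universal_cyclic (L : hilbertType R) (sigma : unitary_rep G L) (w : L) :
  exists V : L -> K, forall a b, cyc sigma w a -> cyc sigma w b ->
    coef sigma a b = coef om (V a) (V b).
Proof.
have [->|w0] := eqVneq w 0.
  exists (fun=> 0) => a b ha _; suff -> : a = 0 by rewrite !coef0l.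
  have c0 : closed_subspace [set x : L | x = 0].
    split=> //= [k x y -> ->|x hx]; first by rewrite scaler0 addr0.
    by apply: nrm_sep => e /hx[y -> ]; rewrite subr0.
  apply: (cspan_min c0) ha => _ [s _ <-] /=.
  exact: (lin0 (rep_linear sigma s)).
have nw : 0 < nrm w.
  by rewrite lt_neqAle nrm_ge0 andbT eq_sym; apply: contra_neq w0 => /nrm_eq0.
have [xi [xiP _ _]] := om_univ.
pose c : R[i] := (nrm w)%:C.
have [w1 nw1 ww1] : exists2 w1, nrm w1 = 1 & w = c *: w1.
  exists ((nrm w)^-1%:C *: w).
    by rewrite nrmZ nrm_real gtr0_norm ?invr_gt0// mulVf// gt_eqF.
  by rewrite scalerA -rmorphM /= mulfV ?gt_eqF// scale1r.
have cf := xiP _ (coef_state sigma nw1).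
set x := xi _ in cf.
pose p s := sigma s w; pose q s := c *: om s x.
have pq s t : inner (p s) (p t) = inner (q s) (q t).
  rewrite /p /q ww1 !(linZ (rep_linear sigma _)) !innerZl !innerZr.
  congr (_ * (_ * _)); have := congr1 (fun f => f (t^-1 * s)%g) cf.
  by rewrite /coef !repM !rep_innerV !invgK => ->.
have ext := graph_dom pq.
have /choice[V hV] : forall a, exists a', cyc sigma w a -> graph p q a a'.
  move=> a; have [ha|ha] := pselect (cyc sigma w a); last by exists 0.
  by have [a' ga] := ext a ha; exists a'.
exists V => a b /hV ga /hV gb; apply/funext => s.
apply: graph_inner pq _ _ _ _ _ gb.
apply: graph_map ga; try exact: rep_linear; try by move=> y; rewrite rep_nrm.
move=> t; exists (s * t)%g; first by rewrite /p repM.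
by rewrite /q (linZ (rep_linear om s)) repM.
Qed.

Lemma universal_coef (L : hilbertType R) (sigma : unitary_rep G L) a b :
  exists x y : K, [/\ coef sigma a b = coef om x y, nrm x <= nrm a & nrm y <= nrm b].
Proof.
have cC := cyc_closed sigma a.
have [V hV] := universal_cyclic sigma a.
pose b1 := oproj (cyc sigma a) b.
have Ca := @cyc_self _ _ _ sigma a; have Cb : cyc sigma a b1 := proj_in cC b.
have nV z : cyc sigma a z -> nrm (V z) = nrm z.
  move=> Cz; have := congr1 (fun f => f 1%g) (hV _ _ Cz Cz).
  rewrite /coef !rep1 => e; apply/eqP.
  by rewrite -(@eqrXn2 _ 2) ?nrm_ge0// !nrm_sqr e.
exists (V a), (V b1); rewrite -hV// !nV//; split=> //; last exact: (proj_nrm cC).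
by apply/funext => s; rewrite /coef (inner_projr cC)//; exact: cyc_gen.
Qed.
End Universal.

Section Bicommutant.
Context {R : realType} {G : topGroupType} {E : hilbertType R} (pi : unitary_rep G E).
Context {I : finType}.
Local Notation L := (@ell2 R I E).

Lemma ell2_sumE (J : finType) (f : J -> L) i : (\sum_j f j) i = \sum_j f j i.
Proof. by apply: (big_morph (fun g : L => g i)). Qed.

Lemma ell2_delta_sum (z : L) : z = \sum_j delta j (z j).
Proof.
apply: ell2_eq => i; rewrite ell2_sumE (bigD1 i)//= eqxx big1 ?addr0// => j.
by rewrite eq_sym => /negbTE ->.
Qed.

Lemma delta_lin j : linear (@delta R I E j).
Proof.
move=> a x y; apply: ell2_eq => i /=; case: ifP => // _.
by rewrite scaler0 addr0.
Qed.

(** The projection onto the cyclic subspace generated by the vector (x_i) of the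
    multiple of pi has matrix entries in the commutant of pi(G). So T
    commutes with these entries, and (T x_i) stays in that cyclic subspace,
    to which (y_i) is orthogonal. *)
Lemma bicommutant T (x y : I -> E) : VN pi T ->
  (forall s, \sum_i inner (pi s (x i)) (y i) = 0) -> \sum_i inner (T (x i)) (y i) = 0.
Proof.
move=> VT h; have lT : linear T by case: (VN_bounded VT).
pose mk (f : I -> E) : L := Ell2 (finite_sqsummable f).
pose X := mk x; pose amp := amplification (I := I) pi.
have cC := cyc_closed amp X; pose P := oproj (cyc amp X).
have lP : linear P := proj_linear cC.
pose Pij i j k := P (delta j k) i.
have PijM i j : commutant (range pi) (Pij i j).
  split.
    apply/bounded_opP; split.
      by move=> a u v; rewrite /Pij delta_lin lP.
    exists 1 => // k; rewrite mul1r; apply: le_trans (ell2_nrm_coord _ _) _.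
    by rewrite -ell2_nrmE (le_trans (proj_nrm cC _))// nrm_delta.
  move=> _ [s _ <-]; apply/funext => k; rewrite /Pij /=.
  have -> : delta j (pi s k) = amp s (delta j k).
    apply: ell2_eq => l /=; case: ifP => // _.
    by rewrite (lin0 (rep_linear pi s)).
  by rewrite /P (proj_comm cC)// => t z; exact: cyc_inv.
have PE (z : L) i : P z i = \sum_j Pij i j (z j).
  by rewrite {1}(ell2_delta_sum z) (lin_sum lP) ell2_sumE.
pose TX := mk (T \o x).
have PTX : P TX = TX.
  apply: ell2_eq => i; rewrite PE.
  have comm j : Pij i j (TX j) = T (Pij i j (X j)).
    have [_ /(_ _ (PijM i j))] := VT; move/(congr1 (fun f => f (X j))) => /=.
    by move=> ->.
  under eq_bigr do rewrite comm.
  rewrite -(lin_sum lT) -PE /P (proj_id cC)//.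
  exact: cyc_self.
have CTX : cyc amp X TX by rewrite -PTX; exact: (proj_in cC).
have : cyc amp X `<=` [set z | inner z (mk y) = 0].
  apply: cspan_min; first exact: orth_closed.
  by move=> _ [s _ <-] /=; rewrite ell2_inner_fin; exact: h.
by move=> /(_ _ CTX) /=; rewrite ell2_inner_fin.
Qed.
End Bicommutant.

(** * The dual map *)

Section UniversalPairing.
Context {R : realType} {H : topGroupType} {K : hilbertType R} (om : unitary_rep H K).
Hypothesis om_univ : is_universal om.

Lemma BG_universal (u : H -> R[i]) : BG u -> exists x y, u = coef om x y.
Proof.
move=> [L [sigma [a [b ->]]]].
by have [x [y [-> _ _]]] := universal_coef om_univ sigma a b; exists x, y.
Qed.

(** The sum is a coefficient of the direct sum of two copies of om. *)
Lemma BG_add (a : R[i]) (x1 y1 x2 y2 : K) :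
  BG (a \*o coef om x1 y1 \+ coef om x2 y2).
Proof.
pose mk (f : bool -> K) : ell2 bool K := Ell2 (finite_sqsummable f).
exists (ell2 bool K : hilbertType R), (amplification om),
  (mk (fun b => if b then a *: x1 else x2)), (mk (fun b => if b then y1 else y2)).
apply/funext => s; rewrite /coef ell2_inner_fin big_bool /=.
by rewrite (linZ (rep_linear om s)) innerZl.
Qed.

(** The bicommutant property of S, applied to the three coefficients in the
    relation; it makes the functional of S on B(H) well defined and linear. *)
Lemma VN_relation S (a : R[i]) (x1 y1 x2 y2 x3 y3 : K) : VN om S ->
  coef om x3 y3 = a \*o coef om x1 y1 \+ coef om x2 y2 ->
  inner (S x3) y3 = a * inner (S x1) y1 + inner (S x2) y2.
Proof.
move=> VS h; have lS : linear S by case: (VN_bounded VS).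
have [b bE] : exists b : R[i], forall z, b * z = - (a * z).
  by exists (- a) => z; rewrite mulNr.
(* the relation says that these three coefficients sum to zero *)
pose x (i : 'I_3) : K := nth 0 [:: x3; b *: x1; - x2] i.
pose y (i : 'I_3) : K := nth 0 [:: y3; y1; y2] i.
have := @bicommutant _ _ _ om 'I_3 S x y VS.
rewrite !big_ord_recl big_ord0 /= => /(_ _).
rewrite /x /y /= (linZ lS) -scaleN1r (linZ lS) !innerZl addr0 mulN1r bE.
move=> H1; apply/eqP; rewrite -subr_eq0 opprD H1// => s.
rewrite !big_ord_recl big_ord0 /= (linZ (rep_linear om s)) (linZ (rep_linear om s)).
rewrite !innerZl addr0 mulN1r bE.
have := congr1 (fun f => f s) h; rewrite /coef /= => ->.
by rewrite -opprD subrr.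
Qed.

(** Each function in B(H) is a coefficient of om with no loss in the norms of
    the vectors, so <om(.)x|y> |-> <Sx|y> is defined and bounded on all of
    B(H). *)
Lemma universal_pairing S : VN om S ->
  dual_space (Api om) (pairing om S) /\
  forall x y, pairing om S (coef om x y) = inner (S x) y.
Proof.
move=> VS; have [lS [M M0 bS]] := (bounded_opP _).1 (VN_bounded VS).
have /choice[z hz] : forall u : H -> R[i], exists z : K * K, BG u -> u = coef om z.1 z.2.
  move=> u; have [/BG_universal[x [y uE]]|nu] := pselect (BG u); last by exists (0, 0).
  by exists (x, y).
pose f u := inner (S (z u).1) (z u).2.
have fE x y : f (coef om x y) = inner (S x) y.
  have := @VN_relation S 0 0 0 x y _ _ VS _.
  move=> /(_ (z (coef om x y)).1 (z (coef om x y)).2); rewrite mul0r add0r; apply.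
  rewrite -hz; last exact: coef_BG.
  by apply/funext => s /=; rewrite mul0r add0r.
apply: (pairingP (f := f)) => //; split=> [a u v [Bu _] [Bv _]|].
  apply: VN_relation => //; rewrite -(hz _ Bu) -(hz _ Bv) -hz//.
  by rewrite (hz _ Bu) (hz _ Bv); exact: BG_add.
exists M => u [Bu _]; apply: BG_norm_ge => // L sigma a b uE.
have [x [y [xyE nx ny]]] := universal_coef om_univ sigma a b.
rewrite uE xyE fE; apply: le_trans (cauchy_schwarz _ _) _.
rewrite mulrA ler_pM ?nrm_ge0//; apply: le_trans (bS _) _.
by rewrite ler_wpM2l.
Qed.

Lemma Api_universal u : BG u -> Api om u.
Proof. by move=> /BG_universal[x [y ->]]; exact: coef_Api. Qed.

Lemma VN_lin (a : R[i]) S T : VN om S -> VN om T -> VN om (fun x => a *: S x + T x).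
Proof.
move=> VS VT.
have [lS [M M0 bS]] := (bounded_opP _).1 (VN_bounded VS).
have [lT [N N0 bT]] := (bounded_opP _).1 (VN_bounded VT).
split.
  apply/bounded_opP; split=> [c x y|].
    by rewrite lS lT !scalerDr !scalerA mulrC addrACA.
  exists (nrm a * M + N) => [|x]; first by rewrite addr_ge0 ?mulr_ge0 ?nrm_ge0.
  apply: le_trans (nrmD _ _) _; rewrite nrmZ mulrDl lerD//.
  by rewrite -mulrA ler_wpM2l ?nrm_ge0.
move=> U cU; have [/bounded_opP[lU _] _] := cU; apply/funext => x /=.
rewrite lU; case: VS => _ /(_ U cU)/(congr1 (fun f => f x)) /= ->.
by case: VT => _ /(_ U cU)/(congr1 (fun f => f x)) /= ->.
Qed.

(** The vectors are split along the cyclic subspace of a nonzero z_m: the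
    components in it embed in the space of om, where the matrix S is
    positive, and among the remainders one more vector is zero. The mixed
    coefficients vanish. *)
Lemma positive_extension (L : hilbertType R) (sigma : unitary_rep H L)
    n (S : 'I_n -> 'I_n -> K -> K) (z : 'I_n -> L) :
  (forall i j, VN om (S i j)) -> positive_opmx S ->
  0 <= \sum_i \sum_j pairing om (S i j) (coef sigma (z j) (z i)).
Proof.
move=> VS pS; have [k] := ubnP #|[pred i | z i != 0]|.
elim: k z => // k IH z zk.
have [z0|/existsNP[m /eqP zm]] := pselect (forall i, z i = 0).
  rewrite big1// => i _; rewrite big1// => j _.
  rewrite !z0 coef0l -(coef0l om 0).
  by have [_ ->] := universal_pairing (VS i j); rewrite inner0r.
have cC := cyc_closed sigma (z m).
pose Q := oproj (cyc sigma (z m)); pose z' i := z i - Q (z i).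
have Qin i : cyc sigma (z m) (Q (z i)) by exact: proj_in.
have split_coef i j : coef sigma (z j) (z i) =
    1 \*o coef sigma (Q (z j)) (Q (z i)) \+ coef sigma (z' j) (z' i).
  apply/funext => s; rewrite /coef /= mul1r.
  have h1 : inner (sigma s (Q (z j))) (z' i) = 0 by apply: proj_orthr => //; exact: cyc_inv.
  have h2 : inner (sigma s (z' j)) (Q (z i)) = 0.
    by rewrite rep_innerV proj_orth//; exact: cyc_inv.
  have orth_add (u u' v v' : L) : inner u v' = 0 -> inner u' v = 0 ->
      inner (u' + u) (v' + v) = inner u v + inner u' v'.
    by move=> e1 e2; rewrite innerDl !innerDr e1 e2 addr0 add0r addrC.
  by rewrite -(orth_add _ _ _ _ h1 h2) -(linD (rep_linear sigma s)) /z' !subrK.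
have [V hV] := universal_cyclic om_univ sigma (z m).
have -> : \sum_i \sum_j pairing om (S i j) (coef sigma (z j) (z i)) =
  (\sum_i \sum_j inner (S i j (V (Q (z j)))) (V (Q (z i)))) +
  \sum_i \sum_j pairing om (S i j) (coef sigma (z' j) (z' i)).
  rewrite -big_split; apply: eq_bigr => i _; rewrite -big_split; apply: eq_bigr => j _ /=.
  have [[lp _] pE] := universal_pairing (VS i j).
  rewrite split_coef lp; try by apply: Api_universal; exact: coef_BG.
  by rewrite mul1r hV// pE.
apply: addr_ge0; first exact: pS.
apply: IH; rewrite -ltnS; apply: leq_trans zk; rewrite ltnS; apply/proper_card/fintype.properP; split.
  apply/fintype.subsetP => i; rewrite !inE; apply: contra_neq => zi.
  by rewrite /z' /Q zi (lin0 (proj_linear cC)) subrr.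
exists m; rewrite !inE ?zm// negbK /z' /Q proj_id ?subrr//; exact: cyc_self.
Qed.
End UniversalPairing.

Section DualMap.
Context {R : realType} {G H : topGroupType} {E : hilbertType R} (pi : unitary_rep G E).
Local Notation A := (Api pi).
Hypothesis A_alg : is_subalgebra A.
Context {K : hilbertType R} (om : unitary_rep H K).
Hypothesis om_univ : is_universal om.
Variable phi : (G -> R[i]) -> (H -> R[i]).
Hypothesis phi_BG : forall u, A u -> BG (phi u) /\ BG_norm (phi u) <= BG_norm u.
Hypothesis phi_lin : forall a u v, A u -> A v -> phi (a \*o u \+ v) = a \*o phi u \+ phi v.

Lemma pullback_dual S : VN om S -> dual_space A (fun u => pairing om S (phi u)).
Proof.
move=> VS; have [dS _] := universal_pairing om_univ VS; have [lS _] := dS.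
have AB : Api om `<=` BG by move=> u [].
have Aphi u : A u -> Api om (phi u) by move=> /phi_BG[/(Api_universal om_univ)].
have [M M0 bS] := dual_bound AB dS.
split=> [a u v Au Av|]; first by rewrite phi_lin// lS//; exact: Aphi.
exists M => u Au; apply: le_trans (bS _ (Aphi _ Au)) _.
by rewrite ler_wpM2l//; case: (phi_BG Au).
Qed.

(** For U in the commutant of pi(G), with adjoint V, the functions <pi(.)Ux|y>
    and <pi(.)x|Vy> coincide; so the operator given by the form commutes
    with U. *)
Lemma dual_map_exists S : VN om S -> exists T, VN pi T /\
  (forall x y, inner (T x) y = pairing om S (phi (coef pi x y))) /\
  forall u, A u -> pairing pi T u = pairing om S (phi u).
Proof.
move=> VS; have df := pullback_dual VS; have [lf _] := df.
have AB : A `<=` BG by case: A_alg.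
have [M M0 bf] := dual_bound AB df.
pose f u := pairing om S (phi u).
have Ac := coef_Api pi.
have [a x x' y|a x y y'|x y|T [bT TE _]] := @form_op _ _ (fun x y => f (coef pi x y)) M _ _ M0.
- by rewrite /f coef_linl lf.
- by rewrite /f coef_linr lf.
- apply: le_trans (bf _ (Ac _ _)) _; rewrite -mulrA ler_wpM2l//.
  exact: BG_norm_le.
have [dT pT] := pairingP df (fun x y => esym (TE x y)).
exists T; split; last first.
  by split=> //; apply: (dual_ext A_alg) => // x y; rewrite pT TE.
split=> // U [bU cU].
have [U' [_ UU']] := adjoint_exists bU.
apply/funext => x; apply: inner_ext => y /=.
rewrite UU' !TE; congr f; apply/funext => s.
have := cU (pi s) (imageT _ s) => /(congr1 (fun g => g x)) /= e.
by rewrite /coef -e UU'.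
Qed.

Lemma completely_positive_dual (L : hilbertType R) (sigma : unitary_rep H L) (V : E -> L) :
  (forall x y, phi (coef pi x y) = coef sigma (V x) (V y)) ->
  exists2 Phi, is_dual_map pi om phi Phi & completely_positive_op (VN om) Phi.
Proof.
move=> phiE.
have /choice[Phi hPhi] : forall S, exists T, VN om S -> VN pi T /\
    (forall x y, inner (T x) y = pairing om S (phi (coef pi x y))) /\
    forall u, A u -> pairing pi T u = pairing om S (phi u).
  move=> S; have [VS|nVS] := pselect (VN om S); last by exists id.
  by have [T hT] := dual_map_exists VS; exists T.
exists Phi; first by move=> S /hPhi[VT [_ hT]].
split=> [a S T VS VT|n S VS pS x].
  have VST := VN_lin a VS VT.
  have [_ [ES _]] := hPhi _ VS; have [_ [ET _]] := hPhi _ VT; have [_ [EST _]] := hPhi _ VST.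
  apply/funext => x; apply: inner_ext => y.
  rewrite innerDl innerZl ES ET EST phiE.
  have [xi [eta ->]] := BG_universal om_univ (coef_BG sigma (V x) (V y)).
  have [_ ->] := universal_pairing om_univ VS.
  have [_ ->] := universal_pairing om_univ VT.
  have [_ ->] := universal_pairing om_univ VST.
  by rewrite innerDl innerZl.
have -> : \sum_i \sum_j inner (Phi (S i j) (x j)) (x i) =
    \sum_i \sum_j pairing om (S i j) (coef sigma (V (x j)) (V (x i))).
  apply: eq_bigr => i _; apply: eq_bigr => j _.
  by have [_ [-> _]] := hPhi _ (VS i j); rewrite phiE.
exact: positive_extension.
Qed.
End DualMap.

Theorem corollary2p6 (R : realType) (G H : topGroupType)
  (hG : locally_compact_group G) (hH : locally_compact_group H)
  (E : hilbertType R) (pi : unitary_rep G E) (A : set (G -> R[i]))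
  (A_eq : A = Api pi) (A_alg : is_subalgebra A) (A_closed : BG_closed A)
  (A_inv : translation_invariant A)
  (star : star_semigroup (spectrum pi))
  (norm1 : forall T, spectrum pi T -> op_norm T = 1)
  (H0 : set H) (H0_sub : is_subgroup H0) (H0_open : open H0)
  (alpha : H -> E -> E)
  (alpha_spec : forall s, H0 s -> spectrum pi (alpha s))
  (alpha_hom : forall s t, H0 s -> H0 t ->
     alpha (s * t)%g = alpha s \o alpha t)
  (alpha_cont : {within H0, continuous (fun h => weak_star pi (alpha h))}) :
  algebra_homomorphism A (j_map pi H0 alpha) /\
  completely_positive pi (j_map pi H0 alpha).
Proof.
subst A.
split; first by apply: j_homomorphism.
have jb := j_bounded A_alg A_closed A_inv norm1 H0_sub H0_open alpha_spec alpha_hom alpha_cont.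
split; first by exists 1 => u Au; rewrite mul1r; case: (jb u Au).
move=> K om om_univ.
have [L [sigma [V jE]]] :=
  j_coef_pi norm1 H0_sub H0_open alpha_spec alpha_hom alpha_cont.
apply: (completely_positive_dual A_alg om_univ jb _ jE) => a u v.
exact: j_linear.
Qed.
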